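(* There is an absolute constant $C$ such that, if $n$ and $m$ are positive integers and $g(n,m)$ denotes the maximum size of a subset of $[n]$ with no subset sum equal to $m$, then \[g(n,m)=s(n,m):=\left\lfloor\frac{n}{\mathrm{snd}(m)}\right\rfloor+\mathrm{snd}(m)-2\] for $m\in\left[Cn\log n,\frac{n^2}{12(\log n)^2}\right]$, and \[g(n,m)=\max\left(s(n,m),(1+o(1))\sqrt{2m}\right)\] for $m\in\left[\frac{n^2}{12(\log n)^2},\binom{n+1}{2}\right]$, where $o(1)$ tends to $0$ as $n\to\infty$.
   Context: $[n]=\{1,\dots,n\}$; a subset sum of a set $S$ is a sum of the elements of some subset of $S$. $\mathrm{snd}(m)$ is the smallest positive integer that does not divide $m$. $\log$ is the natural logarithm. *)

(* Defs.v *)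
From mathcomp Require Import all_boot.
From Stdlib Require Export Reals.

Set Implicit Arguments.
Unset Strict Implicit.
Unset Printing Implicit Defensive.

(* snd m : smallest positive integer not dividing m (for m >= 1; the search
   over k+1 with k < m+1 always succeeds since m+1 does not divide m). *)
Definition snd (m : nat) : nat :=
  (find (fun k => ~~ (k.+1 %| m)) (iota 0 m.+1)).+1.

(* Subsets of [n] = {1,...,n} are sets A : {set 'I_n.+1} with 0 \notin A. *)
Definition in_range (n : nat) (A : {set 'I_n.+1}) : bool := ord0 \notin A.

Definition no_subset_sum (n m : nat) (A : {set 'I_n.+1}) : bool :=
  [forall B : {set 'I_n.+1}, (B \subset A) ==> (\sum_(i in B) (i : nat) != m)].

Definition g (n m : nat) : nat :=
  \max_(A : {set 'I_n.+1} | in_range A && no_subset_sum m A) #|A|.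

(* s(n,m) = floor(n / snd m) + snd m - 2 (snd m >= 2, so no truncation). *)
Definition s (n m : nat) : nat := n %/ snd m + snd m - 2.

(* Main.v *)
(** Let [A] be a subset of [[n]] with more than [s n m] elements, and let
    [d = snd m], which is [O(log n)] by Chebyshev's estimate.  Choose [q]
    maximal such that almost all elements of [A] are multiples of [q]; the size
    of [A] forces [q <= d].  If [q < d] then [q] divides [m]; if [q = d] then at
    least [d - 1] elements of [A] are not multiples of [d], and some of them
    have a sum congruent to [m] modulo [d].  After division by [q] we are left
    with a set [A'] of density [1/K], [K = O(log n)], that has many elements
    prime to any given small prime.

    In a small part [B] of [A'] consider the sums [x] of two elements with many
    representations.  Repeated use of such an [x] costs nothing, since distinct
    elements of [B] can be taken each time.  If [a] is the largest of them,
    Olson's theorem shows that [O(K)] of them fill a subgroup of [Z/a], and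
    [O(K)] further elements of [A'] fill all residues modulo [a].  Adding copies
    of [a] yields an interval of subset sums that starts at [O(K n)] and is
    longer than [n]; the elements outside [B] then extend it greedily up to
    almost the sum of [A'], which is at least about [#|A|^2 / 2].

    The constant 12 in the statement needs [snd m <= c log m] with
    [c < 1.22], hence Chebyshev's quotient
    [(30k)! k! / ((15k)! (10k)! (6k)!)] rather than a central binomial. *)

From Stdlib Require Import Reals Lra ClassicalEpsilon.
Require Import Defs.
From mathcomp Require Import all_boot all_fingroup zmodp cyclic zify.

Set Implicit Arguments.
Unset Strict Implicit.
Unset Printing Implicit Defensive.

Delimit Scope R_scope with R.

(** * Sumsets in abelian groups *)

Section Sumsets.
Import GroupScope.

Lemma mul_submod (gT : finGroupType) (X Y S : {set gT}) :
  #|(X :&: Y) * S| + #|(X :|: Y) * S| <= #|X * S| + #|Y * S|.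
Proof.
rewrite mulUg -(cardsUI (X * S)) addnC leq_add2l subset_leq_card //.
by rewrite subsetI !mulSg ?subsetIl ?subsetIr.
Qed.

Lemma sub_mulr (gT : finGroupType) (X S : {set gT}) :
  1 \in S -> X \subset X * S.
Proof. by move=> S1; apply/subsetP => x Xx; rewrite -[x]mulg1 mem_mulg. Qed.

Lemma olson_card_mulg (gT : finGroupType) (G : {group gT}) (S X : {set gT}) :
  abelian G -> 1 \in S -> <<S>> = G ->
  X \subset G -> X != set0 -> X * S != G -> #|S| + 2 * #|X| <= 2 * #|X * S|.
Proof.
move=> abG S1 genS sXG Xn0 XSG.
pose c (Z : {set gT}) := #|Z|.
pose p (Z : {set gT}) : {set gT} := Z * S.
have pE (Z : {set gT}) : p Z = Z * S by [].
change (c S + 2 * c X <= 2 * c (p X)).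
have cE (Z : {set gT}) : c Z = #|Z| by [].
clearbody c p.
have c_gt0 Z : (0 < c Z) = (Z != set0) by rewrite cE card_gt0.
have leS (Y Z : {set gT}) : Y \subset Z -> c Y <= c Z by rewrite !cE; apply: subset_leq_card.
have sSG : S \subset G by rewrite -genS subset_gen.
(* An atom: a set minimising first the boundary [#|Z * S| - #|Z|], then its
   size.  Submodularity makes it a coset of a subgroup. *)
pose fr (Z : {set gT}) := [&& Z \subset G, Z != set0 & Z * S != G].
pose bd (Z : {set gT}) := c (p Z) - c (Z).
have bdE (Z : {set gT}) : c (p Z) = bd Z + c (Z).
  by rewrite /bd subnK // leS // pE sub_mulr.
clearbody bd.
have frX : fr X by rewrite /fr sXG Xn0.
case: (@arg_minnP _ X fr bd frX) => Z0 frZ0 minZ0.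
pose fr2 Z := fr Z && (bd Z == bd Z0).
have fr2Z0 : fr2 Z0 by rewrite /fr2 frZ0 eqxx.
case: (@arg_minnP _ Z0 fr2 (fun Z => c (Z)) fr2Z0) => Z /andP[frZ /eqP bdZ] minZ.
have sub_XS (Y : {set gT}) : Y \subset G -> Y * S \subset G.
  by move=> sYG; rewrite mul_subG.
have dual : 2 * c (Z) + bd Z0 <= c (G).
  case/and3P: frZ => sZG Zn0 ZSG.
  (* The inverse of the complement of [Z * S] also minimises the boundary. *)
  pose W : {set gT} := (G :\: Z * S)^-1.
  have cW : c (W) + c (p Z) = c (G).
    by rewrite !cE pE card_invg -(cardsID (Z * S) G) (setIidPr (sub_XS _ sZG)) addnC.
  have sWG : W \subset G by rewrite /W -{2}(invGid G) invSg subsetDl.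
  have WS : W * S \subset (G :\: Z)^-1.
    apply/subsetP=> _ /mulsgP[y t Wy St ->].
    move: Wy; rewrite !inE => /andP[yN yG].
    have Gt := subsetP sSG t St.
    rewrite (groupV G) in yG.
    rewrite groupV groupM // andbT; apply: contra yN => Zy.
    have -> : y^-1 = (y * t)^-1 * t.
      by rewrite (centsP abG y yG t Gt) invMg mulgKV.
    exact: mem_mulg.
  have cWS : c (p W) + c (Z) <= c (G).
    rewrite !cE pE -(cardsID Z G) (setIidPr sZG) addnC leq_add2l.
    by rewrite -[X in _ <= X]card_invg subset_leq_card.
  have frW : fr W.
    have cZ : 0 < c (Z) by rewrite c_gt0.
    have cZS : c (p Z) < c (G) by rewrite !cE pE proper_card // properEneq ZSG sub_XS.
    rewrite /fr sWG /= -c_gt0; apply/andP; split; first by clear -cW cZS; lia.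
    by apply/negP=> /eqP E; move: cWS; rewrite pE E; clear -cZ; lia.
  have := minZ0 _ frW; have := bdE W; have := bdE Z; rewrite bdZ => bZ bW le0.
  have bW0 : bd W = bd Z0 by clear -bZ bW le0 cW cWS; lia.
  have := minZ W; rewrite /fr2 frW bW0 eqxx => /(_ isT) /=; clear -bZ cW; lia.
have trans g : g \in G -> g *: Z :&: Z != set0 -> g *: Z = Z.
  move=> Gg In0; case/and3P: (frZ) => sZG Zn0 ZSG.
  set Y : {set gT} := g *: Z in In0 *.
  have sYG : Y \subset G by rewrite /Y mul_subG ?sub1set.
  have YS : c (p Y) = c (p Z) by rewrite !cE !pE /Y -mulgA card_lcoset.
  have cY : c (Y) = c (Z) by rewrite !cE card_lcoset.
  have IS : (Y :&: Z) * S != G.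
    apply: contra ZSG => /eqP E; rewrite eqEsubset sub_XS //= -E.
    by rewrite mulSg ?subsetIr.
  have frI : fr (Y :&: Z).
    by rewrite /fr IS In0 (subset_trans (subsetIr _ _)).
  have cI : ~~ (c (Y :&: Z) < c (Z)).
    apply/negP=> ltI.
    have bdI : bd Z0 < bd (Y :&: Z).
      rewrite ltn_neqAle minZ0 // andbT; apply/eqP=> E.
      by have := minZ (Y :&: Z); rewrite /fr2 frI E eqxx => /(_ isT) /=; clear -ltI; lia.
    have := mul_submod Y Z S; rewrite -!cE -!pE; have := cardsUI Y Z; rewrite -!cE.
    have bI := bdE (Y :&: Z); have bU := bdE (Y :|: Z); have bZ := bdE Z.
    rewrite YS cY => cU subm.
    have bdU : bd (Y :|: Z) < bd Z0 by clear -bI bU bZ bdZ cU subm bdI; lia.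
    have : ~~ fr (Y :|: Z) by apply/negP=> /minZ0; clear -bdU; lia.
    rewrite /fr subUset sYG sZG /=.
    rewrite -c_gt0 (_ : 0 < c (Y :|: Z)); last by move: In0; rewrite -c_gt0; clear -cU ltI; lia.
    rewrite /= negbK => /eqP E.
    by move: bU; rewrite pE E; move: In0; rewrite -c_gt0; clear -dual bdU cU; lia.
  rewrite -leqNgt in cI.
  have /eqP EI : Y :&: Z == Z by rewrite eqEcard subsetIr -!cE.
  have /eqP EI2 : Y :&: Z == Y by rewrite eqEcard subsetIl -!cE cY.
  by rewrite -EI2.
case/and3P: (frZ) => sZG Zn0 ZSG.
have [x0 Zx0] := set0Pn _ Zn0.
have Gx0 : x0 \in G by exact: (subsetP sZG).
pose H0 := x0^-1 *: Z.
have mH0 g : (g \in H0) = (x0 * g \in Z) by rewrite mem_lcoset invgK.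
have H0closed : group_set H0.
  apply/group_setP; split; first by rewrite mH0 mulg1.
  move=> g h; rewrite mH0 => Hg; rewrite !mH0 => Hh.
  have Gg : g \in G by rewrite -(groupMl _ Gx0) (subsetP sZG).
  have E : g *: Z = Z.
    apply: trans => //; apply/set0Pn; exists (x0 * g).
    by rewrite inE Hg andbT mem_lcoset (centsP abG _ Gx0) // mulKg.
  rewrite -E mem_lcoset.
  have Gh : h \in G by rewrite -(groupMl _ Gx0) (subsetP sZG).
  by rewrite !mulgA (centsP abG _ _ x0) ?groupV // -!mulgA mulKg.
pose H := Group H0closed.
have sHG : H \subset G.
  by apply/subsetP=> h; rewrite mH0 => Zh; rewrite -(groupMl _ Gx0) (subsetP sZG).
have HS : c (p H) = c (p Z) by rewrite !cE !pE /= /H0 -mulgA card_lcoset.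
have cH : c (H) = c (Z) by rewrite !cE /= card_lcoset.
have HSG : H * S != G.
  apply: contra ZSG => /eqP E; by rewrite eqEcard sub_XS //= -!cE -pE -HS pE E.
have : ~~ (S \subset H).
  apply: contra HSG => sSH; rewrite eqEsubset sub_XS //=.
  have sGH : <<S>> \subset H by rewrite gen_subG.
  by apply: subset_trans (sub_mulr _ S1); rewrite -genS.
case/subsetPn => t St Ht.
have cHS : 2 * c (H) <= c (p H).
  have <- : c (H :|: H :* t) = (2 * c (H))%N.
    rewrite !cE cardsU card_rcoset (_ : H :&: H :* t = set0) ?cards0; first by clear; lia.
    apply/setP=> y; rewrite !inE; apply/negP=> /andP[Hy].
    rewrite mem_rcoset => Hyt; case/negP: Ht.
    by rewrite -[t]invgK groupV -(groupMl _ Hy).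
  by rewrite leS // pE subUset sub_mulr // mulgS // sub1set.
have cSHS : c (S) <= c (p H).
  rewrite leS // pE; apply/subsetP=> y Sy.
  by rewrite -[y]mul1g mem_mulg.
have := minZ0 _ frX; have := bdE X; have := bdE Z.
move: cHS cSHS; rewrite HS cH; clear -bdZ; lia.
Qed.

Lemma expg_gen_full (gT : finGroupType) (S : {set gT}) (k : nat) :
  abelian <<S>> -> 1 \in S -> 2 * #|<<S>>| < k * #|S| -> S ^+ k = <<S>>.
Proof.
move=> abG S1 lt_k.
pose c (Z : {set gT}) := #|Z|.
have cE (Z : {set gT}) : #|Z| = c Z by [].
move: lt_k; rewrite !cE => lt_k; have {cE} cE (Z : {set gT}) : c Z = #|Z| by [].
clearbody c.
have sXk j : S ^+ j \subset <<S>>.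
  elim: j => [|j IH]; first by rewrite expg0 sub1G.
  by rewrite expgSr mul_subG // subset_gen.
have dich j : S ^+ j = <<S>> \/ j * c S <= 2 * c (S ^+ j).
  elim: j => [|j IH]; first by right; rewrite mul0n.
  have [E|nE] := eqVneq (S ^+ j.+1) <<S>>; first by left.
  right; rewrite expgSr in nE *; case: IH => [E|IH].
    by case/negP: nE; rewrite E eqEsubset mul_subG ?subset_gen //= sub_mulr.
  have Xn0 : S ^+ j != set0.
    by apply/set0Pn; exists 1; elim: (j) => [|i IHi]; rewrite ?expg0 ?set11 // expgS -(mulg1 1) mem_mulg.
  have := @olson_card_mulg _ <<S>>%G S _ abG S1 (erefl _) (sXk j) Xn0 nE.
  by rewrite -!cE; apply: leq_trans; rewrite mulSn leq_add2l.
case: (dich k) => // le_k.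
have := subset_leq_card (sXk k); rewrite -!cE => le_c.
by clear -le_k le_c lt_k; lia.
Qed.

Definition resid_sums (I : finType) (w : I -> nat) (a : nat)
    (H : {set 'I_a.+1}) (F : {set I}) : {set 'I_a.+1} :=
  H * [set inZp (\sum_(i in F') w i) | F' : {set I} in powerset F].

Lemma inZpD (a x y : nat) : (inZp (x + y) : 'I_a.+1) = inZp x * inZp y.
Proof. by apply: val_inj; rewrite /= modnDm. Qed.

Lemma mem_resid_sums (I : finType) (w : I -> nat) (a : nat) (H : {group 'I_a.+1})
    (F : {set I}) (g : 'I_a.+1) :
  reflect (exists2 F' : {set I}, F' \subset F &
             exists2 h, h \in H & g = h * inZp (\sum_(i in F') w i))
          (g \in resid_sums w H F).
Proof.
apply: (iffP mulsgP) => [[h _ Hh /imsetP[F' sF' ->] ->]|[F' sF' [h Hh ->]]].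
  by exists F'; [rewrite -powersetE | exists h].
by exists h (inZp (\sum_(i in F') w i)) => //; apply/imsetP; exists F'; rewrite ?powersetE.
Qed.

Lemma resid_sums_stable (I : finType) (w : I -> nat) (a : nat)
    (H : {group 'I_a.+1}) (F0 : {set I}) :
  exists F : {set I}, [/\ F \subset F0, #|F|.+1 * #|H| <= #|resid_sums w H F| &
    forall b g, b \in F0 :\: F -> g \in resid_sums w H F ->
      g * inZp (w b) \in resid_sums w H F].
Proof.
pose P (F : {set I}) := (F \subset F0) && (#|F|.+1 * #|H| <= #|resid_sums w H F|).
have P0 : P set0.
  rewrite /P sub0set cards0 mul1n subset_leq_card //.
  apply/subsetP=> h Hh; apply/mem_resid_sums; exists set0 => //; exists h => //.
  by rewrite big_set0 (_ : inZp 0 = 1) ?mulg1 //; apply: val_inj; rewrite /= mod0n.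
case: (@arg_maxnP _ set0 P (fun F : {set I} => #|F|) P0) => F /andP[sF cF] maxF.
exists F; split=> // b g; rewrite inE => /andP[bF bF0] gX.
apply/negPn/negP => nX.
set t := inZp (w b) in nX; set y := g * t in nX.
have sX : resid_sums w H F :|: H :* y \subset resid_sums w H (b |: F).
  apply/subsetP=> z; rewrite inE => /orP[/mem_resid_sums[F' sF' [h Hh ->]]|].
    apply/mem_resid_sums; exists F'; last by exists h.
    by rewrite (subset_trans sF') // subsetUr.
  case/rcosetP => h Hh ->; case/mem_resid_sums: gX => F' sF' [h' Hh' Eg].
  apply/mem_resid_sums; exists (b |: F'); first by rewrite setUS.
  exists (h * h'); first by rewrite groupM.
  rewrite big_setU1 /=; last by apply: contra bF; apply/subsetP.
  by rewrite /y Eg addnC inZpD !mulgA.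
have dis : resid_sums w H F :&: H :* y = set0.
  apply/setP=> z; rewrite !inE; apply/negP=> /andP[zX /rcosetP[h Hh Ez]].
  case/negP: nX; move: zX; rewrite Ez => /mem_resid_sums[F' sF' [h' Hh' E]].
  apply/mem_resid_sums; exists F' => //; exists (h^-1 * h'); first by rewrite groupM ?groupV.
  by rewrite -mulgA -E mulKg.
have cU : #|resid_sums w H F| + #|H| <= #|resid_sums w H (b |: F)|.
  have := subset_leq_card sX.
  by rewrite cardsU dis cards0 subn0 card_rcoset.
have Pb : P (b |: F).
  rewrite /P subUset sub1set bF0 sF /= cardsU1 bF.
  apply: leq_trans cU; rewrite add1n mulSn addnC.
  by rewrite leq_add2r.
by have := maxF _ Pb; rewrite /= cardsU1 bF add1n ltnn.
Qed.

Lemma resid_sums_full (I : finType) (w : I -> nat) (a : nat)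
    (H : {group 'I_a.+1}) (F0 : {set I}) (c : nat) :
  a.+1 <= c * #|H| ->
  (forall p, prime p -> p <= c -> c <= #|[set i in F0 | ~~ (p %| w i)]|) ->
  forall g : 'I_a.+1, exists F : {set I}, [/\ F \subset F0, #|F| <= c &
    exists2 h, h \in H & g = h * inZp (\sum_(i in F) w i)].
Proof.
move=> le_a nd.
have [F [sF cF stF]] := resid_sums_stable w H F0.
have H_gt0 : 0 < #|H| by rewrite cardG_gt0.
have le_X : #|resid_sums w H F| <= a.+1.
  by rewrite -[X in _ <= X]card_ord max_card.
have lt_F : #|F| < c by rewrite -(leq_pmul2r H_gt0); apply: leq_trans le_a; apply: leq_trans le_X.
have X1 : 1 \in resid_sums w H F.
  apply/mem_resid_sums; exists set0; rewrite ?sub0set //; exists 1 => //.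
  by rewrite big_set0 (_ : inZp 0 = 1) ?mulg1 //; apply: val_inj; rewrite /= mod0n.
pose M0 := [set g | [forall x in resid_sums w H F, x * g \in resid_sums w H F]].
have M0P g : reflect (forall x, x \in resid_sums w H F -> x * g \in resid_sums w H F) (g \in M0).
  by rewrite inE; apply: (iffP forall_inP).
have gM0 : group_set M0.
  apply/group_setP; split; first by apply/M0P=> x; rewrite mulg1.
  by move=> x y /M0P Mx /M0P My; apply/M0P=> z Xz; rewrite mulgA; apply/My/Mx.
pose M := Group gM0.
have sHM : H \subset M.
  apply/subsetP=> h Hh; apply/M0P=> x /mem_resid_sums[F' sF' [h' Hh' ->]].
  apply/mem_resid_sums; exists F' => //; exists (h * h'); first by rewrite groupM.
  by rewrite Zp_mulgC mulgA.
have le_HM := subset_leq_card sHM.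
have dvM : #|M| %| a.+1.
  by have := cardSg (subsetT M); rewrite cardsT card_ord.
have [i Ea] := dvdnP dvM.
have dvi x : x \in M -> i %| x.
  move=> Mx; have := expg_cardG Mx; rewrite Zp_expg => /(congr1 val) /= x0.
  have : a.+1 %| x * #|M| by rewrite /dvdn x0.
  by rewrite [X in X %| _]Ea dvdn_pmul2r // cardG_gt0.
have le_ic : i <= c.
  have : i * #|M| <= c * #|M| by rewrite -Ea (leq_trans le_a) // leq_mul2l le_HM orbT.
  by rewrite leq_pmul2r // cardG_gt0.
have i1 : i = 1%N.
  apply/eqP; apply: contraT => ni1.
  have i_gt0 : 0 < i by move: Ea; case: (i).
  have i_gt1 : 1 < i by rewrite ltn_neqAle eq_sym ni1.
  have pp := pdiv_prime i_gt1.
  have le_p : pdiv i <= c by apply: leq_trans le_ic; apply: dvdn_leq (pdiv_dvd i).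
  have : ~~ ([set j in F0 | ~~ (pdiv i %| w j)] \subset F).
    apply/negP=> /subset_leq_card le1.
    by have := leq_trans (nd _ pp le_p) le1; rewrite leqNgt lt_F.
  case/subsetPn => b; rewrite inE => /andP[bF0 /negP nb] bF; case: nb.
  have Mb : (inZp (w b) : 'I_a.+1) \in M by apply/M0P => x Xx; apply: stF => //; rewrite inE bF.
  have := dvdn_trans (pdiv_dvd i) (dvi _ Mb) => /=.
  have pa : pdiv i %| a.+1 by rewrite Ea dvdn_mulr // pdiv_dvd.
  by move=> pm; rewrite (divn_eq (w b) a.+1) dvdn_add // dvdn_mull.
have MT : M = [set: 'I_a.+1] :> {set _}.
  by apply/eqP; rewrite eqEcard subsetT cardsT card_ord Ea i1 mul1n leqnn.
move=> g; have : g \in M by rewrite MT inE.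
move/M0P/(_ _ X1); rewrite mul1g => /mem_resid_sums[F' sF' hh].
exists F'; split=> //; first exact: subset_trans sF' sF.
exact: leq_trans (subset_leq_card sF') (ltnW lt_F).
Qed.

End Sumsets.

(** * Intervals of subset sums *)

Section SubsetSums.
Import GroupScope.
Local Open Scope nat_scope.

Definition sum_reps (I : finType) (w : I -> nat) (B : {set I}) (x : nat) : {set I} :=
  [set i in B | [exists j in B, w i + w j == x]].

Lemma popular_sums_distinct (I : finType) (w : I -> nat) (B : {set I}) (R : nat) :
  {in B &, injective w} ->
  forall (l : seq nat) (U : {set I}),
  (forall x, x \in l -> R <= #|sum_reps w B x|) ->
  2 * #|U| + 4 * size l + 2 <= R ->
  exists X : {set I}, [/\ X \subset B, [disjoint X & U] &
    \sum_(i in X) w i = sumn l].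
Proof.
move=> injw; elim=> [|x l IH] U pop leR.
  by exists set0; rewrite sub0set big_set0 -setI_eq0 set0I eqxx.
have popx : R <= #|sum_reps w B x| by apply: pop; rewrite mem_head.
pose h j := odflt j [pick i | (i \in B) && (w i + w j == x)].
pose diag := [set i in B | w i + w i == x].
have cdiag : #|diag| <= 1.
  apply/card_le1_eqP => i j; rewrite !inE => /andP[iB /eqP Ei] /andP[jB /eqP Ej].
  by apply: injw => //; clear -Ei Ej; lia.
have : ~~ (sum_reps w B x \subset U :|: h @: U :|: diag).
  apply/negP=> /subset_leq_card le1.
  have c1 := (leq_card_setU (U :|: h @: U) diag).1.
  have c2 := (leq_card_setU U (h @: U)).1.
  have c3 := leq_imset_card h U.
  move: leR => /=; clear -le1 c1 c2 c3 popx cdiag; lia.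
case/subsetPn => i; rewrite inE => /andP[iB /existsP[j /andP[jB /eqP Eij]]].
rewrite !inE !negb_or iB /= => /andP[/andP[iU ihU] nii].
have jU : j \notin U.
  apply: contra ihU => jU; apply/imsetP; exists j => //.
  rewrite /h; case: pickP => [i' /andP[i'B /eqP E']|/(_ i)]; last by rewrite iB Eij eqxx.
  by rewrite /=; apply: injw => //; lia.
have nij : i != j by apply: contraNneq nii => Eji; rewrite {2}Eji Eij.
have [||X [XB XU EX]] := IH (i |: (j |: U)).
- by move=> y yl; apply: pop; rewrite inE yl orbT.
- have c1 := (leq_card_setU [set i] (j |: U)).1; have c2 := (leq_card_setU [set j] U).1.
  by move: leR c1 c2; rewrite !cards1 /=; lia.
have iX : i \notin X by rewrite (disjointFl XU) // !inE eqxx.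
have jX : j \notin X by rewrite (disjointFl XU) // !inE eqxx orbT.
have UX : [disjoint X & U] by apply: disjointWr XU; rewrite setUA subsetUr.
exists (i |: (j |: X)); split.
- by rewrite !subUset !sub1set iB jB.
- rewrite -setI_eq0 !setIUl !setU_eq0 !setI_eq0 UX andbT.
  by rewrite !disjoints1 iU jU.
rewrite big_setU1 ?inE ?negb_or ?nij ?iX //= big_setU1 //= EX; lia.
Qed.

Lemma popular_sums_card (I : finType) (w : I -> nat) (B : {set I}) (N R : nat) :
  {in B &, injective w} -> (forall i, i \in B -> w i <= N) ->
  #|B| * #|B| <=
    #|[set x : 'I_(2 * N).+1 | R <= #|sum_reps w B x|]| * #|B| + (2 * N).+1 * R.
Proof.
move=> injw leN.
have row i : i \in B ->
    \sum_(x : 'I_(2 * N).+1) [exists j in B, w i + w j == x] = #|B|.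
  move=> iB; rewrite -big_mkcond /= sum1_card.
  have -> : #|B| = #|[set (inord (w i + w j) : 'I_(2 * N).+1) | j in B]|.
    rewrite card_in_imset // => j j' jB j'B /(congr1 val) /=.
    rewrite !inordK ?ltnS; try by have := leN _ iB; have := leN _ jB; have := leN _ j'B; lia.
    by move=> E; apply: injw => //; lia.
  apply: eq_card => x; rewrite unfold_in; apply/existsP/imsetP => [[j /andP[jB /eqP E]]|[j jB ->]].
    by exists j => //; apply: val_inj; rewrite /= E inord_val.
  have lt_ij : w i + w j < (2 * N).+1.
    by rewrite ltnS; have := leN _ iB; have := leN _ jB; clear; lia.
  by exists j; rewrite jB /= inordK.
have -> : #|B| * #|B| = \sum_(x : 'I_(2 * N).+1) #|sum_reps w B x|.
  rewrite -{1}sum1_card big_distrl /=.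
  under eq_bigr => i iB do rewrite mul1n -(row i iB).
  rewrite exchange_big /=; apply: eq_bigr => x _.
  rewrite -sum1_card /= big_mkcond [RHS]big_mkcond /=; apply: eq_bigr => i _.
  by rewrite inE; case: (i \in B) => //=; case: ifP.
rewrite (bigID (fun x : 'I_(2 * N).+1 => R <= #|sum_reps w B x|)) /=.
apply: leq_add.
  rewrite -sum1dep_card big_distrl /=; apply: leq_sum => x _.
  rewrite mul1n subset_leq_card //; apply/subsetP=> i; by rewrite inE => /andP[].
apply: (@leq_trans (\sum_(x : 'I_(2 * N).+1) R)); last by rewrite sum_nat_const card_ord.
rewrite [X in X <= _]big_mkcond /=; apply: leq_sum => x _.
by case: ifP => // ; rewrite -ltnNge => /ltnW.
Qed.

Lemma sum_setU (I : finType) (w : I -> nat) (X Y : {set I}) :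
  [disjoint X & Y] ->
  \sum_(i in X :|: Y) w i = (\sum_(i in X) w i + \sum_(i in Y) w i)%N.
Proof.
by move=> dXY; rewrite -bigU //; apply: eq_bigl => i; rewrite !inE.
Qed.

Lemma expg_sumn (a k : nat) (S : {set 'I_a.+1}) (P : pred nat) :
  (forall g, g \in S -> exists2 x, P x & g = inZp x) ->
  forall g, g \in S ^+ k -> exists l : seq nat,
    [/\ size l = k, all P l & g = inZp (sumn l)].
Proof.
move=> SP; elim: k => [|k IH] g.
  rewrite expg0 inE => /eqP ->; exists nil; split=> //.
  by apply: val_inj; rewrite /= mod0n.
rewrite expgS => /mulsgP[x y /SP[u Pu ->] /IH[l [sl Pl ->]] ->].
by exists (u :: l); split=> /=; rewrite ?sl ?Pu // inZpD.
Qed.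

Lemma sumn_leq (l : seq nat) (M : nat) : all (fun x => x <= M) l -> sumn l <= size l * M.
Proof.
elim: l => //= x l IH /andP[lex /IH lel]; by rewrite mulSn leq_add.
Qed.

Lemma sum_leq_card (I : finType) (w : I -> nat) (F : {set I}) (M : nat) :
  (forall i, i \in F -> w i <= M) -> \sum_(i in F) w i <= #|F| * M.
Proof. by move=> le_w; rewrite -sum_nat_const; apply: leq_sum. Qed.

Lemma interval_in_subset_sums (I : finType) (w : I -> nat) (B F0 : {set I}) (N K y : nat) :
  [disjoint B & F0] -> {in B &, injective w} ->
  (forall i, i \in B -> w i <= N) -> (forall i, i \in F0 -> w i <= N) ->
  0 < K -> N <= K * #|B| -> 2800 * K ^ 3 <= #|B| ->
  (forall p, prime p -> p <= 6 * K -> 6 * K <= #|[set i in F0 | ~~ (p %| w i)]|) ->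
  32 * K * N <= y -> y <= 34 * K * N ->
  exists X : {set I}, X \subset B :|: F0 /\ \sum_(i in X) w i = y.
Proof.
move=> dBF injw leB leF K_gt0 leNB leb nd le_y y_le.
set b := #|B| in leNB leb.
pose R := b %/ (6 * K).
pose D := [set x : 'I_(2 * N).+1 | R <= #|sum_reps w B x|].
have K3 : K ^ 3 = (K * K * K)%N by rewrite !expnS expn0 muln1 mulnA.
have leRb : R * (6 * K) <= b by rewrite leq_trunc_div.
have leR : 462 * K * K + 2 <= R.
  by rewrite leq_divRL ?muln_gt0 ?K_gt0 //; move: leb; rewrite K3; clear -K_gt0; nia.
have b_gt : 2800 <= b by move: leb; rewrite K3; clear -K_gt0; nia.
have N_gt0 : 0 < N.
  case: (posnP N) => // N0.
  have : #|B| <= 1.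
    apply/card_le1_eqP => i j iB jB; apply: injw => //.
    by have := leB _ iB; have := leB _ jB; rewrite N0; clear; lia.
  by rewrite -/b; clear -b_gt; lia.
have cD : b <= 2 * #|D|.
  have := @popular_sums_card I w B N R injw leB; rewrite -/b -/D => le1.
  have le2 : (2 * N).+1 * R * 2 <= b * b.
    have le3 : (2 * N).+1 * R * 2 <= N * (R * 6) by clear -N_gt0; nia.
    have le4 : N * (R * 6) <= K * b * (R * 6) by rewrite leq_mul2r leNB orbT.
    have le5 : b * (R * (6 * K)) <= b * b by rewrite leq_mul2l leRb orbT.
    by clear -le3 le4 le5; nia.
  have le6 : b * b <= b * (2 * #|D|) by clear -le1 le2; nia.
  by move: le6; rewrite leq_pmul2l //; clear -b_gt; lia.
have D_gt0 : 0 < #|D| by clear -cD b_gt; lia.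
have [x0 Dx0] : exists x0, x0 \in D by apply/card_gt0P.
case: (@arg_maxnP _ x0 (fun x => x \in D) (fun x => nat_of_ord x) Dx0) => am Dam maxD.
have le_am : am <= 2 * N by rewrite -ltnS ltn_ord.
have cDa : #|D| <= am.+1.
  have <- : #|[set (inord (nat_of_ord x) : 'I_am.+1) | x in D]| = #|D|.
    rewrite card_in_imset // => x x' Dx Dx' /(congr1 val) /=.
    by rewrite !inordK ?ltnS; [move/val_inj | exact: maxD | exact: maxD].
  by rewrite -[X in _ <= X]card_ord max_card.
have [a Ea] : exists a, nat_of_ord am = a.+1.
  by exists (am : nat).-1; clear -cDa cD b_gt; lia.
pose S := [set (inZp (nat_of_ord x) : 'I_a.+1) | x in D].
have S1 : 1%g \in S.
  by apply/imsetP; exists am => //; apply: val_inj; rewrite /= Ea modnn.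
have cS : #|D| <= #|S|.+1.
  rewrite (cardsD1 am D) Dam add1n ltnS.
  have <- : #|[set (inZp (nat_of_ord x) : 'I_a.+1) | x in D :\ am]| = #|D :\ am|.
    have lt_a (x : 'I_(2 * N).+1) : x \in D :\ am -> x < a.+1.
      rewrite !inE => /andP[xa Dx]; rewrite -Ea ltn_neqAle xa /=; apply: maxD.
      by rewrite inE.
    rewrite card_in_imset // => x x' Dx Dx' /(congr1 val) /=.
    by rewrite !modn_small ?lt_a // => /val_inj.
  by rewrite subset_leq_card // imsetS // subsetDl.
have [cS0 cS0E] : exists c, c = #|S| by exists #|S|.
have b3 : b <= 3 * cS0 by rewrite cS0E; clear -cD cS b_gt; lia.
have le_a : a.+1 <= 6 * K * cS0.
  rewrite -Ea; apply: (leq_trans le_am).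
  apply: (@leq_trans (2 * (K * b))); first by rewrite leq_mul2l leNB orbT.
  by clear -b3; nia.
have abS : abelian <<S>> by apply/centsP => u _ v _; apply: Zp_mulgC.
pose k := (12 * K).+1.
have le_SH : cS0 <= #|<<S>>| by rewrite cS0E subset_leq_card // subset_gen.
have le_Ha : #|<<S>>| <= a.+1 by rewrite -[X in _ <= X]card_ord max_card.
have full : S ^+ k = <<S>>.
  apply: expg_gen_full => //; rewrite -cS0E.
  by move: le_Ha; move: #|<<S>>| => cH; rewrite /k; clear -le_a b3 b_gt; nia.
have le_aH : a.+1 <= 6 * K * #|<<S>>%G|.
  by apply: (leq_trans le_a); rewrite leq_mul2l le_SH orbT.
have [F [sF cF [h Hh Ey]]] := @resid_sums_full I w a <<S>>%G F0 (6 * K) le_aH nd (inZp y).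
pose P (x : nat) := (x <= 2 * N) && (R <= #|sum_reps w B x|).
have SP g : g \in S -> exists2 x, P x & g = inZp x.
  case/imsetP => x Dx ->; exists (nat_of_ord x) => //.
  by move: Dx; rewrite /P inE => ->; rewrite -ltnS ltn_ord.
have hk : h \in S ^+ k by rewrite full.
have [l [sl Pl El]] := expg_sumn SP hk.
set sF0 := \sum_(i in F) w i in Ey.
have le_sF : sF0 <= 6 * K * N.
  apply: leq_trans (sum_leq_card (M := N) _) _; last by rewrite leq_mul2r cF orbT.
  by move=> i /(subsetP sF); apply: leF.
have le_l : sumn l <= k * (2 * N).
  rewrite -sl; apply: sumn_leq; apply: sub_all Pl => x; by case/andP.
have zy : sF0 + sumn l <= y.
  apply: leq_trans le_y; move: le_sF le_l; rewrite /k; clear -K_gt0 N_gt0; nia.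
have : (y == sF0 + sumn l %[mod a.+1])%N.
  by move: Ey; rewrite El -inZpD => /(congr1 val) /= ->; rewrite addnC.
rewrite eqn_mod_dvd // => /dvdnP[j Ej].
have b3a : b <= 3 * a.+1 by rewrite -Ea; clear -cDa cD b_gt; lia.
have le_j : j <= 102 * K * K.
  have : j * a.+1 <= 102 * K * K * a.+1.
    rewrite -Ej; apply: (leq_trans (leq_subr _ _)); apply: (leq_trans y_le).
    apply: (@leq_trans (34 * K * (K * (3 * a.+1)))); last by clear; nia.
    rewrite leq_mul2l; apply/orP; right; apply: (leq_trans leNB).
    by rewrite leq_mul2l b3a orbT.
  by rewrite leq_pmul2r.
have [||X [XB _ EX]] := @popular_sums_distinct I w B R injw (l ++ nseq j a.+1) set0.
- move=> x; rewrite mem_cat => /orP[/(allP Pl)/andP[]//|/nseqP[-> _]].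
  by move: Dam; rewrite inE Ea.
- rewrite cards0 size_cat size_nseq sl muln0 add0n.
  apply: leq_trans leR; rewrite /k; move: le_j; clear -K_gt0; nia.
exists (X :|: F); split; first by rewrite setUSS.
rewrite sum_setU; last first.
  by apply: disjointWl XB _; apply: disjointWr sF _.
rewrite EX sumn_cat sumn_nseq -/sF0; move: Ej zy; rewrite [a.+1 * j]mulnC.
by move: (j * a.+1) => t; clear; lia.
Qed.

Lemma subset_of_size (T : finType) (A : {set T}) (k : nat) :
  k <= #|A| -> exists B : {set T}, B \subset A /\ #|B| = k.
Proof.
case/card_geqP => s [us ss sA]; exists [set x in s]; split.
  by apply/subsetP=> x; rewrite inE; apply: sA.
by rewrite cardsE (card_uniqP us).
Qed.

Lemma subset_sums_extend (I : finType) (w : I -> nat) (Z U : {set I}) (N L m : nat) :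
  [disjoint Z & U] -> (forall i, i \in U -> w i <= N) ->
  (forall y, L <= y -> y <= L + N ->
     exists X : {set I}, X \subset Z /\ \sum_(i in X) w i = y) ->
  L <= m -> m <= L + N + \sum_(i in U) w i ->
  exists X : {set I}, X \subset Z :|: U /\ \sum_(i in X) w i = m.
Proof.
move=> dZU leU sumZ leL leN.
suff [U' [sU lo1 lo hi]] : exists U' : {set I}, [/\ U' \subset U,
    \sum_(i in U') w i <= m, L <= m - \sum_(i in U') w i &
    m - \sum_(i in U') w i <= L + N].
  have [X [sX EX]] := sumZ _ lo hi.
  exists (X :|: U'); split; first by rewrite setUSS.
  rewrite sum_setU ?EX; last by apply: disjointWl sX _; apply: disjointWr sU _.
  by rewrite subnK.
clear sumZ dZU; move: {2}#|U| (leqnn #|U|) => c.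
elim: c U m leU leL leN => [|c IH] U m leU leL leN cU.
  have U0 : U = set0 by apply/eqP; rewrite -cards_eq0 -leqn0.
  exists set0; rewrite sub0set big_set0 subn0; split => //.
  by move: leN; rewrite U0 big_set0 addn0.
have [le_m|lt_m] := leqP m (L + N).
  by exists set0; rewrite sub0set big_set0 subn0.
have [U0|[u uU]] := set_0Vmem U.
  by move: leN; rewrite U0 big_set0 addn0 leqNgt lt_m.
have le_u := leU u uU.
have [||||U' [sU le1 lo hi]] := IH (U :\ u) (m - w u).
- by move=> i /setD1P[_]; apply: leU.
- by clear -lt_m le_u; lia.
- by move: leN; rewrite (big_setD1 u) //=; clear; lia.
- by move: cU; rewrite (cardsD1 u U) uU.
have uU' : u \notin U'.
  by apply/negP=> /(subsetP sU); rewrite !inE eqxx.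
exists (u |: U'); rewrite big_setU1 //=; split.
- by rewrite subUset sub1set uU (subset_trans sU) // subsetDl.
- by clear -le1 lt_m le_u; lia.
- by rewrite subnDA.
- by rewrite subnDA.
Qed.

Lemma card_inj_bound (I : finType) (w : I -> nat) (U : {set I}) (M : nat) :
  {in U &, injective w} -> (forall i, i \in U -> w i < M) -> #|U| <= M.
Proof.
case: M => [|M] injw ltM.
  by rewrite leqn0 cards_eq0; apply/eqP/setP=> i; rewrite inE; apply/negP=> /ltM.
have <- : #|[set (inord (w i) : 'I_M.+1) | i in U]| = #|U|.
  rewrite card_in_imset // => i j iU jU /(congr1 val) /=.
  by rewrite !inordK ?ltM //; apply: injw.
by rewrite -[X in _ <= X]card_ord max_card.
Qed.

Lemma sum_inj_ge (I : finType) (w : I -> nat) (U : {set I}) :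
  {in U &, injective w} -> 'C(#|U|, 2) <= \sum_(i in U) w i.
Proof.
move: {2}#|U| (erefl #|U|) => c; elim: c U => [|c IH] U cU injw; first by rewrite cU.
have [i0 U0] : exists i, i \in U by apply/card_gt0P; rewrite cU.
case: (@arg_maxnP _ i0 (fun i => i \in U) w U0) => u uU maxu.
have cD : #|U :\ u| = c by move: cU; rewrite (cardsD1 u) uU; case.
rewrite (big_setD1 u) //= cU binS bin1 addnC leq_add //.
  have := card_inj_bound injw (M := (w u).+1).
  by rewrite cU ltnS; apply=> i iU; rewrite ltnS; apply: maxu.
rewrite -{1}cD; apply: IH => // i j /setD1P[_ iU] /setD1P[_ jU]; exact: injw.
Qed.

Lemma nondivisible_reserve (I : finType) (w : I -> nat) (A : {set I}) (c : nat) :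
  (forall p, prime p -> p <= c -> c <= #|[set i in A | ~~ (p %| w i)]|) ->
  exists F : {set I}, [/\ F \subset A, #|F| <= c * c &
    forall p, prime p -> p <= c -> c <= #|[set i in F | ~~ (p %| w i)]|].
Proof.
move=> nd.
suff H j : j <= c -> exists F : {set I}, [/\ F \subset A, #|F| <= j * c &
    forall p, prime p -> p <= j -> c <= #|[set i in F | ~~ (p %| w i)]|] by exact: H.
elim: j => [|j IH] le_j.
  exists set0; rewrite sub0set cards0; split=> // p /prime_gt0; by case: p.
have [F [sF cF ndF]] := IH (ltnW le_j).
have [pj|npj] := boolP (prime j.+1); last first.
  exists F; split=> // [|p pp]; first by apply: leq_trans cF _; rewrite leq_mul2r leqnSn orbT.
  rewrite leq_eqVlt => /orP[/eqP Ep|]; last exact: ndF.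
  by rewrite -Ep pp in npj.
have [B [sB cB]] := subset_of_size (nd _ pj le_j).
exists (F :|: B); split.
- rewrite subUset sF; apply: subset_trans sB _; apply/subsetP=> i; by rewrite inE => /andP[].
- by apply: leq_trans (leq_card_setU _ _).1 _; rewrite cB mulSn addnC leq_add2l.
move=> p pp; rewrite leq_eqVlt => /orP[/eqP Ep|lt_p].
  rewrite -[X in X <= _]cB subset_leq_card //; apply/subsetP=> i iB.
  by have := subsetP sB i iB; rewrite !inE Ep iB orbT => /andP[_ ->].
apply: leq_trans (ndF p pp lt_p) _; apply: subset_leq_card; apply/subsetP=> i.
by rewrite !inE => /andP[-> ->].
Qed.

Lemma subset_sums_dense (I : finType) (w : I -> nat) (A : {set I}) (N K e m : nat) :
  let c := 6 * (4 * e * K) in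
  {in A &, injective w} -> (forall i, i \in A -> w i <= N) ->
  0 < K -> 0 < e -> N <= K * #|A| ->
  (forall p, prime p -> p <= c -> c <= #|[set i in A | ~~ (p %| w i)]|) ->
  2800 * (4 * e * K) ^ 3 * (2 * e) <= #|A| ->
  32 * (4 * e * K) * N <= m ->
  m <= 'C(#|A| - #|A| %/ (2 * e) - c * c, 2) ->
  exists X : {set I}, X \subset A /\ \sum_(i in X) w i = m.
Proof.
move=> c injw leN K_gt0 e_gt0 leK nd big lo hi.
have [F [sF cF ndF]] := nondivisible_reserve nd.
set K' := 4 * e * K in c nd big lo hi cF ndF *.
have K'_gt0 : 0 < K' by rewrite !muln_gt0 K_gt0 e_gt0.
have K3 : K' ^ 3 = (K' * K' * K')%N by rewrite !expnS expn0 muln1 mulnA.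
set a := #|A| in leK big hi.
pose b := a %/ (2 * e).
have b_big : 2800 * K' ^ 3 <= b by rewrite leq_divRL ?muln_gt0 ?e_gt0.
have b_le : b * (2 * e) <= a by rewrite leq_trunc_div.
have b_lt : a < b.+1 * (2 * e) by rewrite ltn_ceil // muln_gt0 e_gt0.
have b_ge1 : 1 <= b by apply: leq_trans b_big; rewrite K3; clear -K'_gt0; nia.
have cFb : #|F| + b <= a.
  have le1 : #|F| <= b.
    apply: leq_trans cF _; apply: leq_trans b_big; rewrite /c K3; clear -K'_gt0; nia.
  by clear -le1 b_le e_gt0; nia.
have [|B [sB cB]] := @subset_of_size I (A :\: F) b.
  by have := cardsID F A; rewrite (setIidPr sF) -/a; clear -cFb; lia.
have dBF : [disjoint B & F].
  by rewrite -setI_eq0; apply/eqP/setP=> i; rewrite !inE; apply/negP=> /andP[/(subsetP sB)]; rewrite inE => /andP[/negP].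
have sBA : B \subset A by apply: subset_trans sB (subsetDl _ _).
have leKB : N <= K' * #|B|.
  have le_a4 : a <= 4 * e * b by clear -b_lt b_ge1 e_gt0; nia.
  apply: (leq_trans leK); rewrite cB /K' -mulnA [K * b]mulnC mulnA [K * a]mulnC.
  by rewrite leq_mul2r le_a4 orbT.
pose U := A :\: (B :|: F).
have sBF : B :|: F \subset A by rewrite subUset sBA.
have -> : A = (B :|: F) :|: U.
  by rewrite /U -{1}(setID A (B :|: F)) (setIidPr sBF).
apply: (@subset_sums_extend _ _ _ _ N (32 * K' * N)) => //.
- by rewrite -setI_eq0 setIDA setDIl setDv set0I eqxx.
- by move=> i; rewrite inE => /andP[_]; apply: leN.
- move=> y lo_y hi_y.
  apply: (@interval_in_subset_sums _ _ _ _ N K') => //.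
  + by move=> i j iB jB; apply: injw; apply: (subsetP sBA).
  + by move=> i iB; apply: leN; apply: (subsetP sBA).
  + by move=> i iF; apply: leN; apply: (subsetP sF).
  + by rewrite cB.
  + by apply: (leq_trans hi_y); clear -K'_gt0; nia.
apply: (leq_trans hi).
apply: leq_trans (leq_addl _ _); apply: leq_trans (sum_inj_ge _); last first.
  by move=> i j; rewrite !inE => /andP[_ iA] /andP[_ jA]; apply: injw.
apply: leq_bin2l.
have := cardsID (B :|: F) A; rewrite (setIidPr sBF) -/a.
have := (leq_card_setU B F).1; rewrite cB -/U -/b.
move: cF; move: (c * c) => cc; clear; lia.
Qed.

Lemma residue_subset_sum (I : finType) (w : I -> nat) (E : {set I}) (d m : nat) :
  0 < d -> (forall i, i \in E -> ~~ (d %| w i)) -> d <= #|E|.+1 ->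
  (forall j, 0 < j -> j < d -> j %| m) ->
  exists F : {set I}, F \subset E /\ \sum_(i in F) w i = m %[mod d].
Proof.
case: d => // a _ ndE leE dvm.
pose H := [1 'I_a.+1]%G.
have [F [sF cF stF]] := resid_sums_stable w H E.
suff : (inZp m : 'I_a.+1) \in resid_sums w H F.
  case/mem_resid_sums => F' sF' [h]; rewrite inE => /eqP -> /(congr1 val).
  rewrite mul1g /= => Em.
  by exists F'; split; rewrite ?Em // (subset_trans sF').
have [sEF|] := boolP (E \subset F).
  have EF : F = E by apply/eqP; rewrite eqEsubset sF.
  have -> : resid_sums w H F = [set: 'I_a.+1].
    apply/eqP; rewrite eqEcard subsetT cardsT card_ord.
    by apply: leq_trans leE _; apply: leq_trans cF; rewrite cards1 muln1 EF.
  by rewrite inE.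
case/subsetPn => b bE bF.
have X1 : 1%g \in resid_sums w H F.
  apply/mem_resid_sums; exists set0; rewrite ?sub0set //; exists 1%g; rewrite ?group1 //.
  by rewrite big_set0 (_ : inZp 0 = 1%g) ?mulg1 //; apply: val_inj; rewrite /= mod0n.
have Xj j : (inZp (j * w b) : 'I_a.+1) \in resid_sums w H F.
  elim: j => [|j IH].
    by rewrite mul0n (_ : inZp 0 = 1%g) //; apply: val_inj; rewrite /= mod0n.
  by rewrite mulSn addnC inZpD; apply: stF => //; rewrite inE bF.
have ndb := ndE b bE.
have wb : 0 < w b by rewrite lt0n; apply: contraNneq ndb => ->.
case: (egcdnP a.+1 wb) => km kn Ek _.
set g := gcdn (w b) a.+1 in Ek.
have g_gt0 : 0 < g by rewrite gcdn_gt0 wb.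
have lt_g : g < a.+1.
  rewrite ltn_neqAle dvdn_leq ?dvdn_gcdr // andbT.
  by apply: contraNneq ndb => <-; rewrite dvdn_gcdl.
have [t Et] := dvdnP (dvm g g_gt0 lt_g).
have := Xj (t * km); rewrite -mulnA Ek mulnDr -Et mulnA.
set z := inZp _; suff -> : z = inZp m by [].
by apply: val_inj; rewrite /= modnMDl.
Qed.

Lemma card_multiples_leq (I : finType) (w : I -> nat) (A : {set I}) (n q : nat) :
  {in A &, injective w} -> (forall i, i \in A -> 0 < w i <= n) -> 0 < q ->
  #|[set i in A | q %| w i]| <= n %/ q.
Proof.
move=> injw rg q_gt0.
have rq i : i \in [set i in A | q %| w i] -> exists k, [/\ w i = (k.+1 * q)%N, k < n %/ q & i \in A].
  rewrite inE => /andP[iA /dvdnP[[|k] Ek]]; have /andP[w0 wn] := rg i iA.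
    by rewrite Ek mul0n in w0.
  by exists k; split=> //; rewrite leq_divRL // -Ek.
apply: (@card_inj_bound _ (fun i => (w i %/ q).-1)).
  move=> i j /rq[k [Ei _ iA]] /rq[l [Ej _ jA]]; rewrite Ei Ej !mulnK //= => Ekl.
  by apply: injw => //; rewrite Ei Ej Ekl.
by move=> i /rq[k [-> lt_k _]]; rewrite mulnK.
Qed.

Lemma subset_sum_of_large_set (I : finType) (w : I -> nat) (A : {set I}) (n K e d m : nat) :
  {in A &, injective w} -> (forall i, i \in A -> 0 < w i <= n) ->
  0 < K -> 0 < e -> n <= K * #|A| -> K * (2800 * (1100 * (e ^ 4 * K ^ 3))) <= n ->
  0 < d <= K -> (forall j, 0 < j -> j < d -> j %| m) ->
  n %/ d + d <= #|A|.+1 ->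
  257 * e * K * n <= m -> m <= 'C(#|A| - #|A| %/ e, 2) ->
  exists X : {set I}, X \subset A /\ \sum_(i in X) w i = m.
Proof.
move=> injw rg K_gt0 e_gt0 leK big /andP[d_gt0 leqdK] dvm card_A lo hi.
set a := #|A| in leK card_A hi.
pose c := 6 * (4 * e * (2 * K)).
have E4 : e ^ 4 * K ^ 3 = (e * e * e * e * (K * K * K))%N.
  by rewrite !expnS !expn0 !muln1 !mulnA.
set Z := e ^ 4 * K ^ 3 in big E4.
have bigA : 2800 * (1100 * Z) <= a.
  by rewrite -(leq_pmul2l K_gt0) (leq_trans big).
clearbody Z.
have Z1 : 1 <= Z by rewrite E4 !muln_gt0 e_gt0 K_gt0.
have Z2 : e * K * K * K <= Z.
  have -> : Z = (e * K * K * K * (e * e * e))%N by rewrite E4; clear; nia.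
  by rewrite leq_pmulr // !muln_gt0 e_gt0.
have Z3 : e * K * K <= Z by clear -Z2 K_gt0; nia.
pose Y := e * e * (K * K).
have Z4 : Y * e <= Z.
  have -> : Z = (Y * e * (e * K))%N by rewrite E4 /Y; clear; nia.
  by rewrite leq_pmulr // muln_gt0 e_gt0.
have Z5 : e * K * K <= Y.
  by rewrite /Y -!mulnA leq_mul2l leq_pmull ?orbT.
have Z8 : Y <= Z by apply: leq_trans Z4; rewrite leq_pmulr.
have Z6 : K <= Z by apply: leq_trans Z3; rewrite leq_pmull // muln_gt0 e_gt0.
have Z7 : e * K <= Z by apply: leq_trans Z3; rewrite leq_pmulr.
pose nd q := #|[set i in A | ~~ (q %| w i)]|.
pose P q := [&& 0 < q, q <= 2 * K & nd q <= c * q].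
have P1 : P 1.
  rewrite /P /= muln_gt0 K_gt0 /nd (_ : [set i in A | _] = set0) ?cards0 //.
  by apply/setP=> i; rewrite !inE dvd1n andbF.
have PQ q : P q -> q <= 2 * K by case/and3P.
case: (ex_maxnP (ex_intro P 1 P1) PQ) => q /and3P[q_gt0 le_q nd_q] maxq.
pose A1 := [set i in A | q %| w i].
have sA1 : A1 \subset A by apply/subsetP=> i; rewrite inE => /andP[].
have cA1 : #|A1| + nd q = a.
  rewrite /a -(cardsID [set i | q %| w i] A); congr (_ + _); apply: eq_card => i;
    by rewrite !inE // andbC.
have cq : c * q <= 96 * Y.
  have : c * q <= c * (2 * K) by rewrite leq_mul2l le_q orbT.
  by rewrite /c; clear -Z5; nia.
have cc : c * c <= 2304 * Y by rewrite /c /Y; clear; nia.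
have cZ : c <= 48 * Z by rewrite /c; clear -Z7; nia.
have leA1 : #|A1| <= n %/ q by apply: card_multiples_leq.
have le_qd : q <= d.
  rewrite leqNgt; apply/negP=> lt_dq.
  have h1 : n %/ q <= n %/ d.+1 by apply: leq_div2l.
  have h2 : n %/ d.+1 * d.+1 <= n by apply: leq_trunc_div.
  have h3 : n < (n %/ d).+1 * d by rewrite ltn_ceil.
  have h4 : n < (n %/ d).+1 * K by apply: (leq_trans h3); rewrite leq_mul2l leqdK orbT.
  have h5 : 2800 * (1100 * Z) <= n %/ d.
    have : K * (2800 * (1100 * Z)) < K * (n %/ d).+1 by apply: leq_ltn_trans big _; rewrite mulnC.
    by rewrite ltn_pmul2l.
  have cqd : c * q * d.+1 <= 192 * Z.
    have t1 : c * q <= c * (2 * K) by rewrite leq_mul2l le_q orbT.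
    have t2 : c * q * d.+1 <= c * (2 * K) * (2 * K) by apply: leq_mul => //; clear -leqdK K_gt0; lia.
    by apply: (leq_trans t2); rewrite /c; clear -Z2 Z3; nia.
  have h6 : n %/ d + d <= (c * q + n %/ d.+1).+1 by clear -h1 leA1 nd_q cA1 card_A; lia.
  move: (n %/ d) (n %/ d.+1) h2 h3 h5 h6 => x y h2 h3 h5 h6.
  have h7 : y * d.+1 < x.+1 * d by apply: leq_ltn_trans h2 h3.
  have h8 : (x + d) * d.+1 <= (c * q + y).+1 * d.+1 by rewrite leq_mul2r h6 orbT.
  have h9 : x <= c * q * d.+1 + 2 * d.
    by move: (c * q) h8 => cq' h8; clear -h7 h8 d_gt0; nia.
  by clear -h9 h5 cqd Z6 leqdK Z1; lia.
have [E [sE dEA le_sE qE]] : exists E : {set I}, [/\ E \subset A, [disjoint A1 & E],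
    \sum_(i in E) w i <= K * n & \sum_(i in E) w i = m %[mod q]].
  have [lt_qd|ge_qd] := ltnP q d.
    exists set0; rewrite sub0set big_set0 -setI_eq0 setI0 eqxx; split=> //.
    by rewrite mod0n; apply/esym/eqP; exact: dvm.
  have Eq : q = d by apply/eqP; rewrite eqn_leq le_qd.
  have [|E0 [sE0 cE0]] := @subset_of_size I [set i in A | ~~ (q %| w i)] d.-1.
    rewrite -/(nd q); move: card_A leA1; rewrite Eq; move: cA1; rewrite Eq; clear -d_gt0; lia.
  have E0P i : i \in E0 -> (i \in A) && ~~ (q %| w i).
    by move=> /(subsetP sE0); rewrite inE.
  have [|||F [sF EF]] := @residue_subset_sum I w E0 d m d_gt0.
  - by move=> i /E0P /andP[_]; rewrite Eq.
  - by rewrite cE0; clear -d_gt0; lia.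
  - exact: dvm.
  exists F; split.
  - by apply/subsetP=> i /(subsetP sF) /E0P /andP[].
  - rewrite -setI_eq0; apply/eqP/setP=> i; rewrite !inE; apply/negP=> /andP[/andP[_ qi]].
    by move/(subsetP sF)/E0P; rewrite qi andbF.
  - apply: leq_trans (sum_leq_card (M := n) _) _.
      by move=> i /(subsetP sF) /E0P /andP[/rg /andP[_ ->]].
    rewrite leq_mul2r; apply/orP; right; apply: leq_trans (subset_leq_card sF) _.
    by rewrite cE0; clear -leqdK; lia.
  - by rewrite Eq.
set sg := \sum_(i in E) w i in le_sE qE.
have le_sg : sg <= m.
  apply: leq_trans le_sE _; apply: leq_trans lo.
  by rewrite leq_mul2r; apply/orP; right; clear -e_gt0; nia.
have [m1 Em1] : exists m1, m - sg = (m1 * q)%N.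
  by apply/dvdnP; rewrite -eqn_mod_dvd // qE.
have [|||||||||X [sX EX]] :=
    @subset_sums_dense I (fun i => w i %/ q) A1 (n %/ q) (2 * K) e m1; rewrite -/c.
- move=> i j; rewrite !inE => /andP[iA qi] /andP[jA qj] Eij.
  by apply: injw => //; rewrite -(divnK qi) -(divnK qj) Eij.
- by move=> i /(subsetP sA1) /rg /andP[_ le_wi]; apply: leq_div2r.
- by rewrite muln_gt0.
- exact: e_gt0.
- apply: (leq_trans (leq_div _ _)); apply: (leq_trans leK).
  rewrite [2 * K]mulnC -mulnA leq_mul2l; apply/orP; right.
  by clear -bigA cA1 nd_q cq Z8; lia.
- move=> p pp le_pc; rewrite leqNgt; apply/negP=> lt_c.
  have ndp : nd (p * q) <= nd q + #|[set i in A1 | ~~ (p %| w i %/ q)]|.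
    apply: leq_trans (leq_card_setU _ _).1; apply: subset_leq_card.
    apply/subsetP=> i; rewrite !inE => /andP[-> ndpq] /=.
    case: (boolP (q %| w i)) => //= qi; apply: contra ndpq => pd.
    by rewrite -(divnK qi) dvdn_pmul2r.
  have p_gt1 := prime_gt1 pp.
  have ndp2 : nd (p * q) <= c * q + c.
    by clear -ndp nd_q lt_c; lia.
  have [le_pq|lt_pq] := leqP (p * q) (2 * K).
    have : P (p * q).
      rewrite /P le_pq muln_gt0 q_gt0 prime_gt0 //=.
      apply: (leq_trans ndp2); rewrite -mulnSr leq_mul2l; apply/orP; right.
      by clear -p_gt1 q_gt0; nia.
    move/maxq; rewrite leqNgt => /negP; apply.
    by rewrite ltn_Pmull.
  have mult : #|[set i in A | p * q %| w i]| <= n %/ (p * q).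
    by apply: card_multiples_leq; rewrite // muln_gt0 q_gt0 prime_gt0.
  have tot : #|[set i in A | p * q %| w i]| + nd (p * q) = a.
    rewrite /a -(cardsID [set i | p * q %| w i] A); congr (_ + _); apply: eq_card => i;
      by rewrite !inE // andbC.
  have half : 2 * (n %/ (p * q)) <= a.
    have K2 : 0 < 2 * K by rewrite muln_gt0.
    have s1 : n %/ (p * q) <= n %/ (2 * K) by apply: leq_div2l => //; apply: ltnW.
    have s2 : n %/ (2 * K) * (2 * K) <= n by apply: leq_trunc_div.
    have s3 : K * (2 * (n %/ (2 * K))) <= K * a.
      by apply: leq_trans leK; apply: leq_trans s2; move: (n %/ _) => t; clear; nia.
    by move: s3; rewrite leq_pmul2l //; clear -s1; lia.
  by clear -half tot mult ndp2 cq cZ bigA Z1 Z8; lia.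
- have -> : 2800 * (4 * e * (2 * K)) ^ 3 * (2 * e) = (2800 * (1024 * Z))%N.
    by rewrite E4 !expnS expn0 muln1; clear; nia.
  by clear -cA1 nd_q cq bigA Z1 Z8; lia.
- have lo2 : 32 * (4 * e * (2 * K)) * n <= m - sg.
    have le_n : n * K <= e * K * n by rewrite mulnC leq_mul2r leq_pmull ?orbT.
    by move: lo le_sE; clear -le_n; nia.
  have : 32 * (4 * e * (2 * K)) * (n %/ q) * q <= m1 * q.
    rewrite -Em1; apply: leq_trans lo2; rewrite -mulnA leq_mul2l leq_trunc_div orbT //.
  by rewrite leq_pmul2r.
- have m1m : m1 <= m.
    have : m1 <= m1 * q by rewrite leq_pmulr.
    by rewrite -Em1; clear; lia.
  apply: (leq_trans m1m); apply: (leq_trans hi); apply: leq_bin2l.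
  have u1 : a %/ (2 * e) * 2 <= a %/ e.
    by rewrite leq_divRL // -mulnA leq_trunc_div.
  have u2 : #|A1| %/ (2 * e) <= a %/ (2 * e) by apply: leq_div2r; clear -cA1; lia.
  have u3 : 4800 * Y <= a %/ e.
    rewrite leq_divRL //; apply: leq_trans bigA; rewrite -mulnA.
    by clear -Z4; lia.
  by move: u1 u2 u3 cc cA1; clear -nd_q cq; lia.
exists (X :|: E); split; first by rewrite subUset sE (subset_trans sX).
rewrite sum_setU; last by apply: disjointWl sX _.
have -> : \sum_(i in X) w i = (\sum_(i in X) w i %/ q) * q.
  rewrite big_distrl /=; apply: eq_bigr => i /(subsetP sX).
  by rewrite inE => /andP[_ qi]; rewrite divnK.
by rewrite EX -Em1 -/sg subnK.
Qed.

End SubsetSums.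

(** * Chebyshev's estimate *)

Lemma dvdn_lt_snd (m j : nat) : 0 < j -> j < snd m -> j %| m.
Proof.
case: j => // j _; rewrite /snd ltnS => lt_j.
have := before_find 0 lt_j; rewrite nth_iota ?add0n; last first.
  by apply: leq_trans lt_j _; rewrite -[X in _ <= X](size_iota 0) find_size.
by move/negbFE.
Qed.

Lemma snd_ndvdn (m : nat) : 0 < m -> ~~ (snd m %| m).
Proof.
move=> m_gt0.
have hs : has (fun k => ~~ (k.+1 %| m)) (iota 0 m.+1).
  apply/hasP; exists m; first by rewrite mem_iota add0n ltnSn.
  by apply/negP=> /dvdn_leq; rewrite ltnn => /(_ m_gt0).
have := nth_find 0 hs; rewrite nth_iota ?add0n //.
by move: hs; rewrite has_find size_iota.
Qed.

Lemma snd_ge2 (m : nat) : 0 < m -> 2 <= snd m.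
Proof.
move=> m_gt0; have := snd_ndvdn m_gt0; have : 0 < snd m by [].
by case: (snd m) => [|[|d]] // _; rewrite dvd1n.
Qed.

Lemma chebyshev_floor (k P : nat) : 0 < P ->
  30 * k %/ P + k %/ P <= 15 * k %/ P + 10 * k %/ P + 6 * k %/ P + (P <= 30 * k).
Proof.
move=> P_gt0; set u := 30 * k %/ P.
have q c c' : c * c' = 30 -> c * k %/ P = u %/ c'.
  move=> Ec; have c'_gt0 : 0 < c' by case: c' Ec => [|//]; rewrite muln0.
  by rewrite /u -divnMA -Ec -mulnA [c' * k]mulnC mulnA divnMr.
rewrite (q 15 2) // (q 10 3) // (q 6 5) // -[X in u + X %/ P]mul1n (q 1 30) //.
have -> : (P <= 30 * k) = (0 < u) by rewrite /u divn_gt0.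
by move: u {q} => u; lia.
Qed.

Lemma logn_fact_trunc (p x M : nat) : prime p -> x <= M ->
  logn p x`! = \sum_(1 <= i < M.+1) x %/ p ^ i.
Proof.
move=> pp le_x; rewrite logn_fact // (@big_cat_nat _ _ _ x.+1 1 M.+1) //=.
rewrite [X in _ = (_ + X)]big_nat_cond [X in _ = (_ + X)]big1 ?addn0 // => i.
case/andP=> /andP[lt_i _] _; apply: divn_small.
by apply: leq_trans (ltn_expl _ (prime_gt1 pp)); apply: ltnW.
Qed.

Lemma chebyshev_dvdn (k m : nat) : 0 < m ->
  (forall j, 0 < j -> j <= 30 * k -> j %| m) ->
  (30 * k)`! * k`! %| m * ((15 * k)`! * (10 * k)`! * (6 * k)`!).
Proof.
move=> m_gt0 dvm; set M := 30 * k.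
apply/dvdn_partP => [|p]; first by rewrite muln_gt0 !fact_gt0.
rewrite mem_primes => /andP[pp _]; rewrite p_part pfactor_dvdn //; last first.
  by rewrite !muln_gt0 m_gt0 !fact_gt0.
rewrite !lognM ?muln_gt0 ?m_gt0 ?fact_gt0 //.
have le_M c : c <= 30 -> c * k <= M by move=> ?; rewrite leq_mul2r; apply/orP; right.
have -> : logn p k`! = \sum_(1 <= i < M.+1) k %/ p ^ i.
  by apply: logn_fact_trunc => //; rewrite -[k]mul1n le_M.
rewrite !(@logn_fact_trunc p _ M) ?le_M // -!big_split /=.
pose t := trunc_log p M.
have le_t : \sum_(1 <= i < M.+1) (p ^ i <= M) <= logn p m.
  have [M0|M_gt0] := posnP M; first by rewrite M0 big_geq.
  apply: (@leq_trans t).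
    rewrite big_add1 /= big_mkord.
    apply: (@leq_trans (\sum_(i < M) (i < t))).
      apply: leq_sum => i _; case: (leqP (p ^ i.+1) M) => // le_p.
      by rewrite /t (trunc_log_max (prime_gt1 pp) le_p).
    rewrite -big_mkcond /= sum1_card -[X in _ <= X]card_ord.
    have : #|[pred i : 'I_M | i < t]| <= t.
      rewrite cardE -(size_map val) -[X in _ <= X](size_iota 0); apply: uniq_leq_size.
        by rewrite map_inj_uniq ?enum_uniq //; apply: val_inj.
      by move=> x /mapP[i]; rewrite mem_enum inE => lt_i ->; rewrite mem_iota.
    by rewrite card_ord.
  rewrite -pfactor_dvdn //; apply: dvm; first by rewrite expn_gt0 prime_gt0.
  by rewrite trunc_logP // prime_gt1.
apply: leq_trans (leq_add le_t (leqnn _)); rewrite -big_split /=.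
apply: leq_sum => i _; rewrite addnC [X in _ <= X]addnC addnC.
by apply: chebyshev_floor; rewrite expn_gt0 prime_gt0.
Qed.

Lemma INR_muln (a b : nat) : INR (a * b) = (INR a * INR b)%R.
Proof. exact: mult_INR. Qed.

Lemma INR_addn (a b : nat) : INR (a + b) = (INR a + INR b)%R.
Proof. exact: plus_INR. Qed.

Lemma INR_leq (a b : nat) : a <= b -> (INR a <= INR b)%R.
Proof. by move/leP; apply: le_INR. Qed.

Lemma leq_INR (a b : nat) : (INR a <= INR b)%R -> a <= b.
Proof. by move/INR_le/leP. Qed.

Lemma INR_pos (a : nat) : 0 < a -> (0 < INR a)%R.
Proof. by move/ltP; apply: lt_0_INR. Qed.

Lemma ln_le_sub1 (x : R) : (0 < x)%R -> (ln x <= x - 1)%R.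
Proof.
move=> x0; have := exp_ineq1_le (ln x); rewrite exp_ln //; lra.
Qed.

Lemma ln_ge_1_sub_inv (x : R) : (0 < x)%R -> (1 - / x <= ln x)%R.
Proof.
move=> x0; have := ln_le_sub1 (Rinv_0_lt_compat _ x0); rewrite ln_Rinv //; lra.
Qed.

Lemma ln_fact_bounds (x : nat) : 0 < x ->
  (INR x * ln (INR x) - INR x <= ln (INR x`!) <= INR x * ln (INR x) - INR x + 1 + ln (INR x))%R.
Proof.
elim: x => // x IH _; case: (posnP x) => [->|x0].
  by rewrite /= ln_1; lra.
have X0 := INR_pos x0; have {IH} := IH x0.
rewrite factS INR_muln ln_mult; [|exact: INR_pos|by apply: INR_pos; rewrite fact_gt0].
rewrite S_INR; set X := INR x; set F := ln (INR x`!) => IH.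
have X0' : (0 < X)%R by [].
have r0 : (0 < (X + 1) / X)%R by apply: Rdiv_lt_0_compat; lra.
have E : ln (X + 1) = (ln X + ln ((X + 1) / X))%R.
  by rewrite -ln_mult //; congr ln; field; lra.
have u := ln_le_sub1 r0; have l := ln_ge_1_sub_inv r0.
have u' : (X * ln ((X + 1) / X) <= 1)%R.
  have := Rmult_le_compat_l X _ _ (Rlt_le _ _ X0') u.
  by have -> : (X * ((X + 1) / X - 1) = 1)%R by field; lra.
have l' : (1 <= (X + 1) * ln ((X + 1) / X))%R.
  have X1 : (0 <= X + 1)%R by lra.
  have := Rmult_le_compat_l (X + 1) _ _ X1 l.
  by have -> : ((X + 1) * (1 - / ((X + 1) / X)) = 1)%R by field; lra.
rewrite E; nra.
Qed.

Lemma exp_pow_INR (x : R) (n : nat) : (exp x ^ n = exp (INR n * x))%R.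
Proof.
elim: n => [|n IH]; first by rewrite /= Rmult_0_l exp_0.
by rewrite -tech_pow_Rmult IH S_INR -exp_plus; congr exp; lra.
Qed.

Lemma exp1_le : (exp 1 <= 11 / 4)%R.
Proof.
have h : (exp (-1/64) >= 63 / 64)%R.
  by have := exp_ineq1_le (-1/64); lra.
have p n : (exp (-1/64) ^ n >= (63/64) ^ n)%R.
  by apply: Rle_ge; apply: pow_incr; lra.
have := p 64%nat; rewrite exp_pow_INR.
have -> : (INR 64 * (-1/64) = -1)%R by rewrite INR_IZR_INZ /=; lra.
have -> : (exp (-1) = / exp 1)%R by rewrite -exp_Ropp.
have e0 := exp_pos 1.
move=> h2.
have h3 : (4/11 <= (63/64)^64)%R by lra.
have h4 : (exp 1 * / exp 1 = 1)%R by apply: Rinv_r; lra.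
nra.
Qed.

Lemma chebyshev_constant : (27 <= 14 * ln 2 + 9 * ln 3 + 5 * ln 5)%R.
Proof.
have l1 : (1 <= ln (11/4))%R.
  have := exp1_le => h; rewrite -(ln_exp 1); case: h => [h|->]; last by lra.
  by left; apply: ln_increasing => //; apply: exp_pos.
have pn n x : (0 < x)%R -> (ln (x ^ n) = INR n * ln x)%R by move=> x0; apply: ln_pow.
have E : (14 * ln 2 + 9 * ln 3 + 5 * ln 5 = ln (2 ^ 14 * 3 ^ 9 * 5 ^ 5))%R.
  have p2 : (0 < 2 ^ 14)%R by apply: pow_lt; lra.
  have p3 : (0 < 3 ^ 9)%R by apply: pow_lt; lra.
  have p5 : (0 < 5 ^ 5)%R by apply: pow_lt; lra.
  rewrite (ln_mult _ _ (Rmult_lt_0_compat _ _ p2 p3) p5) (ln_mult _ _ p2 p3).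
  rewrite (pn 14%nat 2%R) ?(pn 9%nat 3%R) ?(pn 5%nat 5%R); try lra.
  by rewrite !INR_IZR_INZ.
rewrite E.
have : (ln ((11/4) ^ 27) <= ln (2 ^ 14 * 3 ^ 9 * 5 ^ 5))%R.
  left; apply: ln_increasing; first by apply: pow_lt; lra.
  by lra.
by rewrite pn; [rewrite INR_IZR_INZ /=|]; lra.
Qed.

Lemma ln_snd_bound (k m : nat) : 0 < m -> 0 < k -> 30 * k < snd m ->
  (27 * INR k <= ln (INR m) + 3 + 3 * ln (15 * INR k))%R.
Proof.
move=> m_gt0 k_gt0 lt_k.
have k0 := INR_pos k_gt0; have m0 := INR_pos m_gt0.
have : (30 * k)`! * k`! <= m * ((15 * k)`! * (10 * k)`! * (6 * k)`!).
  apply: dvdn_leq; first by rewrite !muln_gt0 m_gt0 !fact_gt0.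
  by apply: chebyshev_dvdn => // j j0 le_j; apply: dvdn_lt_snd => //; apply: leq_ltn_trans lt_k.
move/INR_leq; rewrite !INR_muln.
have f0 x : (0 < INR x`!)%R by apply: INR_pos; rewrite fact_gt0.
have l30 : (0 < INR (30 * k)`! * INR k`!)%R by apply: Rmult_lt_0_compat.
move=> le1.
have {le1} : (ln (INR (30 * k)`! * INR k`!) <=
  ln (INR m * (INR (15 * k)`! * INR (10 * k)`! * INR (6 * k)`!)))%R.
  by case: le1 => [lt1|->]; [left; apply: ln_increasing | right].
rewrite !ln_mult //; try lra; try by repeat apply: Rmult_lt_0_compat.
have c0 c : 0 < c -> 0 < c * k by move=> c0; rewrite muln_gt0 c0.
have [b30 _] := ln_fact_bounds (c0 30 isT); have [b1 _] := ln_fact_bounds k_gt0.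
have [_ b15] := ln_fact_bounds (c0 15 isT); have [_ b10] := ln_fact_bounds (c0 10 isT).
have [_ b6] := ln_fact_bounds (c0 6 isT).
have Ec c : INR (c * k) = (IZR (Z.of_nat c) * INR k)%R by rewrite INR_muln INR_IZR_INZ.
rewrite !Ec /= in b30 b15 b10 b6.
have Lc c : (0 < c)%R -> ln (c * INR k) = (ln c + ln (INR k))%R by move=> cc; rewrite ln_mult.
rewrite !Lc in b30 b15 b10 b6; try lra.
have e30 : ln 30 = (ln 2 + ln 3 + ln 5)%R by rewrite -!ln_mult; try lra; congr ln; lra.
have e15 : ln 15 = (ln 3 + ln 5)%R by rewrite -!ln_mult; try lra; congr ln; lra.
have e10 : ln 10 = (ln 2 + ln 5)%R by rewrite -!ln_mult; try lra; congr ln; lra.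
have e6 : ln 6 = (ln 2 + ln 3)%R by rewrite -!ln_mult; try lra; congr ln; lra.
have p2 : (0 < ln 2)%R by rewrite -ln_1; apply: ln_increasing; lra.
have p3 : (ln 2 < ln 3)%R by apply: ln_increasing; lra.
have p5 : (ln 3 < ln 5)%R by apply: ln_increasing; lra.
rewrite e30 e15 e10 e6 in b30 b15 b10 b6 *.
have cst := Rmult_le_compat_l _ _ _ (Rlt_le _ _ k0) chebyshev_constant.
set L := ln (INR k) in b30 b1 b15 b10 b6 *.
move=> le1; nra.
Qed.

Lemma snd_le_ln (n m : nat) : 0 < m -> (50000 <= ln (INR n))%R -> (INR m <= INR n ^ 2)%R ->
  (INR (snd m) <= 23 / 10 * ln (INR n))%R.
Proof.
move=> m_gt0 Ln le_m; set L := ln (INR n) in Ln *.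
have n0 : (0 < INR n)%R.
  case: (posnP n) => [n0|]; last exact: INR_pos.
  move: Ln; rewrite /L n0 /= /ln; case: Rlt_dec => [h|_]; last by lra.
  by exfalso; lra.
have m0 := INR_pos m_gt0.
have lnm : (ln (INR m) <= 2 * L)%R.
  have -> : (2 * L = ln (INR n ^ 2))%R by rewrite ln_pow.
  by case: le_m => [lt1|->]; [left; apply: ln_increasing | right].
set d := snd m; apply: Rnot_lt_le => lt_d.
pose k := d.-1 %/ 30.
have d_gt0 : 0 < d by [].
have hk : 30 * k < d by rewrite /k; lia.
have hd : d <= 30 * k + 30 by rewrite /k; lia.
have d0 : (115000 <= INR d)%R by lra.
have k_gt0 : 0 < k.
  rewrite lt0n; apply/eqP => k0; move: hd; rewrite k0 => /INR_leq.
  have -> : INR (30 * 0 + 30) = 30%R by rewrite INR_IZR_INZ.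
  by lra.
have b := ln_snd_bound m_gt0 k_gt0 hk.
have k0 := INR_pos k_gt0.
have Ek : (INR d <= 30 * INR k + 30)%R.
  by have := INR_leq hd; rewrite INR_addn INR_muln (INR_IZR_INZ 30).
have Ek2 : (15 * INR k <= INR d)%R.
  have := INR_leq (ltnW hk); rewrite INR_muln.
  have -> : INR 30 = 30%R by rewrite INR_IZR_INZ.
  by lra.
have lnd : (ln (15 * INR k) <= INR d / 200 + 198)%R.
  have -> : (15 * INR k = 200 * (15 * INR k / 200))%R by field.
  rewrite ln_mult; try lra.
  have := @ln_le_sub1 200; have := @ln_le_sub1 (15 * INR k / 200); lra.
lra.
Qed.

(** * Lower bounds for [g] *)

Lemma g_geq (n m : nat) (A : {set 'I_n.+1}) : in_range A ->
  (forall B : {set 'I_n.+1}, B \subset A -> \sum_(i in B) (i : nat) <> m) -> #|A| <= g n m.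
Proof.
move=> rA nA; apply: (@leq_bigmax_cond _ _ (fun A : {set 'I_n.+1} => #|A|)).
by rewrite rA; apply/forallP=> B; apply/implyP=> /nA /eqP.
Qed.

Lemma g_attained (n m : nat) : 0 < m -> exists A : {set 'I_n.+1}, [/\ in_range A,
  forall B : {set 'I_n.+1}, B \subset A -> \sum_(i in B) (i : nat) <> m & #|A| = g n m].
Proof.
move=> m_gt0; rewrite /g.
pose P (A : {set 'I_n.+1}) := in_range A && no_subset_sum m A.
have P0 : P set0.
  rewrite /P /in_range inE /=; apply/forallP=> B; apply/implyP; rewrite subset0 => /eqP ->.
  by rewrite big_set0 eq_sym -lt0n.
have cP : 0 < #|[pred A | P A]| by apply/card_gt0P; exists set0.
have [A /andP[rA /forallP nA] EA] := @eq_bigmax_cond _ P (fun A : {set 'I_n.+1} => #|A|) cP.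
exists A; split=> //.
by move=> B sB; apply/eqP; exact: (implyP (nA B) sB).
Qed.

Lemma g_geq_segment (n m k : nat) : k <= n -> 'C(k.+1, 2) < m -> k <= g n m.
Proof.
move=> le_k lt_m.
pose A := [set inord j.+1 | j : 'I_k] : {set 'I_n.+1}.
have vj (j : 'I_k) : (inord j.+1 : 'I_n.+1) = j.+1 :> nat.
  by rewrite inordK // ltnS (leq_trans (ltn_ord j)).
have <- : #|A| = k.
  rewrite card_imset ?card_ord // => i j /(congr1 val) /=; rewrite !vj.
  by case=> /val_inj.
apply: g_geq.
  by rewrite /in_range; apply/imsetP=> -[j _ /(congr1 val)] /=; rewrite vj.
move=> B sB E; move: lt_m; rewrite -E ltnNge => /negP; apply.
rewrite -bin2_sum big_mkord (big_ord_widen n.+1 (fun i => i)) ?ltnS //.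
rewrite [X in X <= _]big_mkcond [X in _ <= X]big_mkcond /=; apply: leq_sum => i _.
case: ifP => // /(subsetP sB) /imsetP[j _ ->]; by rewrite vj ltnS ltn_ord.
Qed.

Lemma g_geq_seq (n m : nat) (l : seq nat) : uniq l -> all (fun x => 0 < x <= n) l ->
  (forall f : nat -> bool, \sum_(x <- l) f x * x <> m) -> size l <= g n m.
Proof.
move=> ul /allP rl nl.
pose A := [set i : 'I_n.+1 | (i : nat) \in l].
have cA : #|A| = size l.
  rewrite -(size_map (fun x => inord x : 'I_n.+1)); set l' := map _ l.
  have vl x : x \in l -> (inord x : 'I_n.+1) = x :> nat.
    by move=> /rl /andP[_ le_x]; rewrite inordK.
  have ul' : uniq l'.
    rewrite map_inj_in_uniq // => x y xl yl /(congr1 val) /=; by rewrite !vl.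
  rewrite -(card_uniqP ul'); apply: eq_card => i; rewrite inE; apply/idP/mapP => [il|[x xl ->]].
    by exists (i : nat) => //; rewrite inord_val.
  by rewrite vl.
rewrite -cA; apply: g_geq.
  by rewrite /in_range inE; apply/negP=> /rl.
move=> B sB E; case: (nl (fun x => inord x \in B)); rewrite -E.
rewrite (eq_big_seq (fun x => \sum_(i in B) (if (i : nat) == x then x else 0))).
  rewrite exchange_big /=; apply: eq_bigr => i iB.
  have il : (i : nat) \in l by have := subsetP sB i iB; rewrite inE.
  rewrite (bigD1_seq (i : nat)) //= eqxx big1 ?addn0 // => x; by rewrite eq_sym => /negbTE ->.
move=> x xl; have /andP[_ le_x] := rl x xl.
have vx : (inord x : 'I_n.+1) = x :> nat by rewrite inordK.
case: (boolP (inord x \in B)) => [xB|xB].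
  rewrite (bigD1 (inord x)) //= vx eqxx big1 ?mul1n ?addn0 // => i /andP[_ ni].
  by case: eqP => // Ei; case/negP: ni; apply/eqP/val_inj; rewrite /= vx.
rewrite mul0n big1 // => i iB; case: eqP => // Ei; case/negP: xB.
by rewrite -Ei inord_val.
Qed.

Lemma g_geq_s_wide (n m : nat) : 0 < m -> snd m * (snd m - 2) <= n.+1 -> s n m <= g n m.
Proof.
move=> m_gt0; rewrite /s; have d2 := snd_ge2 m_gt0; have ndm := snd_ndvdn m_gt0.
move: (snd m) d2 ndm => d d2 ndm wide.
have d_gt0 : 0 < d by apply: ltnW.
set r := m %% d.
have r_gt0 : 0 < r by rewrite lt0n.
have r_lt : r < d by rewrite ltn_mod.
have rd (j : nat) : j < d.-2 -> j.+1 * d <= n.+1.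
  by move=> lt_j; apply: leq_trans wide; rewrite mulnC leq_mul2l; apply/orP; right; lia.
(* Sums of [r - 1] elements congruent to [1] and [d - r - 1] congruent to [-1]
   have residues between [r + 1 - d] and [r - 1], never [r]. *)
pose M := [set inord (j.+1 * d) | j : 'I_(n %/ d)] : {set 'I_n.+1}.
pose P := [set inord (j * d + 1) | j : 'I_r.-1] : {set 'I_n.+1}.
pose Q := [set inord (j.+1 * d - 1) | j : 'I_(d - r).-1] : {set 'I_n.+1}.
have vM (j : 'I_(n %/ d)) : (inord (j.+1 * d) : 'I_n.+1) = j.+1 * d :> nat.
  by rewrite inordK // ltnS -leq_divRL.
have vP (j : 'I_r.-1) : (inord (j * d + 1) : 'I_n.+1) = j * d + 1 :> nat.
  have lt_j := ltn_ord j; have := rd j; rewrite mulSn => h.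
  by rewrite inordK //; have := h; lia.
have vQ (j : 'I_(d - r).-1) : (inord (j.+1 * d - 1) : 'I_n.+1) = j.+1 * d - 1 :> nat.
  have lt_j := ltn_ord j; have := rd j; rewrite mulSn => h.
  by rewrite inordK //; have := h; lia.
have resM i : i \in M -> (i : nat) %% d = 0.
  by case/imsetP => j _ ->; rewrite vM modnMl.
have resP i : i \in P -> (i : nat) %% d = 1 /\ 2 < d.
  case/imsetP => j _ ->; have := ltn_ord j => lt_j.
  by rewrite vP modnMDl modn_small; lia.
have resQ i : i \in Q -> (i : nat) %% d = d.-1 /\ 2 < d.
  case/imsetP => j _ ->; have := ltn_ord j => lt_j; rewrite vQ.
  have -> : j.+1 * d - 1 = j * d + d.-1 by rewrite mulSn; lia.
  by rewrite modnMDl modn_small; lia.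
have cM : #|M| = n %/ d.
  rewrite card_imset ?card_ord // => i j /(congr1 val) /=; rewrite !vM => /eqP.
  by rewrite eqn_pmul2r // eqSS => /eqP /val_inj.
have cP : #|P| = r.-1.
  rewrite card_imset ?card_ord // => i j /(congr1 val) /=; rewrite !vP => /eqP.
  by rewrite eqn_add2r eqn_pmul2r // => /eqP /val_inj.
have cQ : #|Q| = (d - r).-1.
  rewrite card_imset ?card_ord // => i j /(congr1 val) /=; rewrite !vQ => E.
  have {}E : i.+1 * d = j.+1 * d by move: E; rewrite !mulSn; lia.
  by move/eqP: E; rewrite eqn_pmul2r // eqSS => /eqP /val_inj.
have dMP : [disjoint M & P].
  rewrite -setI_eq0; apply/eqP/setP=> i; rewrite !inE; apply/negP=> /andP[/resM E0].
  by case/resP; rewrite E0.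
have dMPQ : [disjoint M :|: P & Q].
  rewrite -setI_eq0; apply/eqP/setP=> i; rewrite !inE; apply/negP=> /andP[/orP[/resM E0|/resP[E0 _]]];
  by case/resQ; rewrite E0; clear; lia.
have cA : #|M :|: P :|: Q| = n %/ d + d - 2.
  rewrite cardsU (disjoint_setI0 dMPQ) cards0 cardsU (disjoint_setI0 dMP) cards0 !subn0.
  by rewrite cM cP cQ; lia.
rewrite -cA; apply: g_geq.
  rewrite /in_range !inE !negb_or; apply/andP; split; first (apply/andP; split).
  - by apply/imsetP=> -[j _ /(congr1 val)] /=; rewrite vM mulSn; lia.
  - by apply/negP=> /resP [] /=; rewrite mod0n.
  - by apply/negP=> /resQ [] /=; rewrite mod0n; lia.
move=> B sB E.
have Er : \sum_(i in B) (i : nat) = \sum_(i in B) ((i \in P) + (i \in Q) * d.-1) %[mod d].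
  rewrite -modn_summ; congr (_ %% d); apply: eq_bigr => i iB.
  have := subsetP sB i iB; rewrite !inE -orbA => /or3P[iM|iP|iQ].
  - have -> : (i \in P) = false by apply/negP=> iP; have := disjointFr dMP iM; rewrite iP.
    have -> : (i \in Q) = false by apply/negP=> iQ; have := disjointFl dMPQ iQ; rewrite inE iM.
    by rewrite resM.
  - have -> : (i \in Q) = false by apply/negP=> iQ; have := disjointFl dMPQ iQ; rewrite inE iP orbT.
    by rewrite iP; have [-> _] := resP i iP.
  - have -> : (i \in P) = false by apply/negP=> iP; have := disjointFl dMPQ iQ; rewrite inE iP orbT.
    by rewrite iQ; have [-> _] := resQ i iQ; rewrite mul1n.
have cnt (X : {set 'I_n.+1}) : \sum_(i in B) (i \in X : nat) <= #|X|.
  rewrite -sum1_card big_mkcond [X in _ <= X]big_mkcond /=; apply: leq_sum => i _.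
  by case: (i \in B); case: (i \in X).
have := cnt P; have := cnt Q; rewrite cP cQ.
move: Er; rewrite E big_split /= -big_distrl /=.
move: (\sum_(i in B) (i \in P : nat)) (\sum_(i in B) (i \in Q : nat)) => p q Er le_q le_p.
have : m + q = p %[mod d].
  rewrite -modnDml Er modnDml -addnA -mulnSr prednK //.
  by rewrite addnC modnMDl.
rewrite -modnDml -/r !modn_small; lia.
Qed.

Lemma g_geq_s (n m : nat) : 0 < n -> 0 < m -> m <= 'C(n.+1, 2) -> s n m <= g n m.
Proof.
move=> n_gt0 m_gt0 le_m.
have [wide|narrow] := leqP (snd m * (snd m - 2)) n.+1; first exact: g_geq_s_wide.
have [lt_s|ge_s] := ltnP 'C((s n m).+1, 2) m.
  apply: g_geq_segment => //; rewrite -ltnS ltnNge; apply/negP=> lt_n.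
  by have := leq_ltn_trans (leq_bin2l 2 (leqW lt_n)) (leq_trans lt_s le_m); rewrite ltnn.
have dvm := @dvdn_lt_snd m; have d2 := snd_ge2 m_gt0.
move: ge_s; rewrite /s; move: (snd m) dvm d2 narrow => d dvm d2 narrow ge_s.
have d3 : 3 <= d by move: narrow; case: d d2 {dvm ge_s} => [|[|[|d]]].
have nd : n %/ d <= d - 3.
  by rewrite -ltnS -[X in _ < X](_ : d - 2 = _); [rewrite ltn_divLR //; lia | lia].
have ge2 : m <= (2 * d - 5) * (d - 2).
  apply: (leq_trans ge_s); apply: (@leq_trans 'C((2 * d - 5).+1, 2)); first by apply: leq_bin2l; lia.
  have E : (2 * d - 5).+1 * (2 * d - 5) = ((2 * d - 5) * (d - 2)).*2 by rewrite -mul2n; nia.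
  by rewrite bin2 /= E doubleK.
have dv12 : (d - 1) * (d - 2) %| m.
  rewrite Gauss_dvd; first by rewrite !dvm //; lia.
  have -> : d - 1 = (d - 2).+1 by lia.
  by rewrite coprimeSn.
have [t Et] := dvdnP dv12.
have t1 : t = 1.
  have t_gt0 : 0 < t by move: m_gt0; rewrite Et; case: (t).
  have : t * ((d - 1) * (d - 2)) <= (2 * d - 5) * (d - 2) by rewrite -Et.
  rewrite mulnA leq_pmul2r; last by clear -d3; lia.
  by clear -t_gt0 d3; nia.
rewrite t1 mul1n in Et.
have d5 : d <= 5.
  rewrite leqNgt; apply/negP=> d6.
  have : d - 3 %| m by apply: dvm; lia.
  have -> : m = d * (d - 3) + 2 by rewrite Et; nia.
  by rewrite dvdn_addr ?dvdn_mull // => /dvdn_leq; lia.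
have [d3E|[d4E|d5E]] : d = 3 \/ d = 4 \/ d = 5 by lia.
- have n1 : n = 1 by lia.
  by move: le_m; rewrite Et d3E n1.
- have Em : m = 6 by rewrite Et d4E.
  have n6 : n <= 6 by lia.
  have s3 : n %/ d + d - 2 = 3.
    have n1 : n %/ 4 <= 1 by lia.
    by move: ge_s; rewrite Em d4E; move: (n %/ 4) n1 => u; case: u => [|[|u]].
  rewrite s3; have n4 : 4 <= n by move: s3; rewrite d4E; lia.
  apply: (@g_geq_seq _ _ [:: 1; 3; 4]) => //=; first by rewrite andbT; lia.
  by move=> f; rewrite !big_cons big_nil Em; case: (f 1); case: (f 3); case: (f 4).
- have Em : m = 12 by rewrite Et d5E.
  have n13 : n <= 13 by lia.
  have s5 : n %/ d + d - 2 = 5.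
    have n2 : n %/ 5 <= 2 by lia.
    move: ge_s; rewrite Em d5E; move: (n %/ 5) n2 => u; by case: u => [|[|[|u]]].
  rewrite s5; have n10 : 10 <= n by move: s5; rewrite d5E; lia.
  apply: (@g_geq_seq _ _ [:: 4; 5; 6; 9; 10]) => //=; first by rewrite andbT; lia.
  by move=> f; rewrite !big_cons big_nil Em; case: (f 4); case: (f 5); case: (f 6); case: (f 9); case: (f 10).
Qed.

Lemma g_geq_sqrt (n m : nat) : 0 < m -> m <= 'C(n.+1, 2) ->
  (sqrt (2 * INR m) - 2 <= INR (g n m))%R.
Proof.
move=> m_gt0 le_m.
have P0 : exists k, 'C(k.+1, 2) < m by exists 0.
have Pm k : 'C(k.+1, 2) < m -> k <= m.
  by rewrite binS bin1 => lt_k; apply: leq_trans (ltnW lt_k); apply: leq_addl.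
case: (ex_maxnP P0 Pm) => k lt_k maxk.
have le_g : k <= g n m.
  apply: g_geq_segment => //; rewrite -ltnS ltnNge; apply/negP=> lt_n.
  by have := leq_ltn_trans (leq_bin2l 2 (leqW lt_n)) (leq_trans lt_k le_m); rewrite ltnn.
have ge_m : m <= 'C(k.+2, 2).
  by rewrite leqNgt; apply/negP=> /maxk; rewrite ltnn.
have ge_m2 : 2 * m <= k.+2 * k.+1.
  by have := mul_bin_diag k.+2 1; rewrite /= bin1 => ->; rewrite leq_mul2l.
have := INR_leq ge_m2; rewrite !INR_muln !S_INR => h.
have h1 : (sqrt (2 * INR m) <= INR k + 2)%R.
  have k0 := pos_INR k.
  rewrite -(sqrt_Rsqr (INR k + 2)); last lra.
  by apply: sqrt_le_1_alt; rewrite /Rsqr; simpl in h; nra.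
have := INR_leq le_g; lra.
Qed.

(** * Upper bounds for [g] *)

Lemma g_upper (n m K e : nat) : 0 < m -> 0 < K -> 0 < e -> snd m <= K ->
  K * (2800 * (1100 * (e ^ 4 * K ^ 3))) <= n -> 257 * e * K * n <= m ->
  s n m < g n m -> 'C(g n m - g n m %/ e, 2) < m.
Proof.
move=> m_gt0 K_gt0 e_gt0 le_dK big lo lt_sg.
have [A [rA nA cA]] := g_attained n m_gt0.
rewrite ltnNge; apply/negP; rewrite -cA => hi.
have d2 := snd_ge2 m_gt0.
have card_A : n %/ snd m + snd m <= #|A|.+1.
  by move: lt_sg; rewrite -cA /s; clear -d2; lia.
have [|||||||||||X [sX EX]] :=
  @subset_sum_of_large_set _ (fun i : 'I_n.+1 => (i : nat)) A n K e (snd m) m.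
- by move=> i j _ _; apply: val_inj.
- move=> i iA; rewrite -[i <= n]ltnS ltn_ord andbT lt0n.
  by apply: contraNneq rA => i0; rewrite (_ : ord0 = i) //; apply: val_inj.
- exact: K_gt0.
- exact: e_gt0.
- have h : n < (n %/ snd m).+1 * snd m by rewrite ltn_ceil //; apply: ltnW.
  have h1 : (n %/ snd m).+1 <= #|A| by move: card_A d2; clear; lia.
  by apply: (leq_trans (ltnW h)); rewrite mulnC leq_mul.
- exact: big.
- by rewrite le_dK andbT; apply: ltnW.
- by move=> j; apply: dvdn_lt_snd.
- exact: card_A.
- exact: lo.
- exact: hi.
exact: (nA X sX EX).
Qed.

Lemma INR_bin2 (x : nat) : INR 'C(x, 2) = (INR x * (INR x - 1) / 2)%R.
Proof.
case: x => [|x]; first by rewrite /=; lra.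
have := congr1 INR (mul_bin_diag x.+1 1).
by rewrite bin1 !INR_muln S_INR /= => E; lra.
Qed.

Lemma nat_between (x : R) : (0 <= x)%R -> exists k : nat, (x <= INR k <= x + 1)%R.
Proof.
move=> x0; have [h1 h2] := archimed x.
have z0 : Z.le 0 (up x) by apply: le_IZR; lra.
have [k Ek] := IZN _ z0.
by exists k; rewrite INR_IZR_INZ -Ek; lra.
Qed.

Lemma exp_ge_pow5 (x : R) : (0 <= x)%R -> (x ^ 5 / 3125 <= exp x)%R.
Proof.
move=> x0.
have E : exp x = (exp (x / 5) ^ 5)%R.
  by rewrite exp_pow_INR; congr exp; rewrite INR_IZR_INZ /=; field.
have h : ((x / 5) ^ 5 <= exp (x / 5) ^ 5)%R.
  by apply: pow_incr; have := exp_ineq1_le (x / 5); lra.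
by rewrite E; apply: Rle_trans h; right; field.
Qed.

(* [2.3 ln n] bounds [snd m] for [m <= n ^ 2]. *)
Lemma density_parameter (e : nat) : 0 < e -> exists L0 : R, (50000 <= L0)%R /\
  forall n : nat, 0 < n -> (L0 <= ln (INR n))%R -> exists K : nat,
  [/\ 0 < K, K * (2800 * (1100 * (e ^ 4 * K ^ 3))) <= n,
      (23 / 10 * ln (INR n) <= INR K <= 3 * ln (INR n))%R &
      (INR e * 1000000 * ln (INR n) ^ 3 <= INR n)%R].
Proof.
move=> e_gt0; have e0 := INR_leq e_gt0; rewrite /= in e0.
pose c := (3125 * (2800 * 1100 * 81) * INR e ^ 4)%R.
have e4 : (1 <= INR e ^ 4)%R by apply: pow_R1_Rle.
have e41 : (INR e <= INR e ^ 4)%R.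
  have : (1 <= INR e ^ 3)%R by apply: pow_R1_Rle.
  by move=> h; rewrite -[X in (X <= _)%R]Rmult_1_r -tech_pow_Rmult; apply: Rmult_le_compat_l; lra.
have c_ge : (50000 <= c)%R by rewrite /c; lra.
exists c; split=> // n n_gt0; set L := ln (INR n) => le_L.
have n0 := INR_pos n_gt0.
have nE : INR n = exp L by rewrite /L exp_ln.
have L0 : (50000 <= L)%R by lra.
have nL : (L ^ 5 / 3125 <= INR n)%R by rewrite nE; apply: exp_ge_pow5; lra.
have L4 : (0 < L ^ 4)%R by apply: pow_lt; lra.
have cL : (c * L ^ 4 / 3125 <= INR n)%R.
  apply: Rle_trans nL; rewrite -[(L ^ 5)%R]/(L * L ^ 4)%R.
  have := Rmult_le_compat_r _ _ _ (Rlt_le _ _ L4) le_L; lra.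
have [|K [K1 K2]] := @nat_between (23 / 10 * L)%R; first by lra.
have K3 : (INR K <= 3 * L)%R by lra.
exists K; split.
- by apply: leq_INR; rewrite /=; lra.
- apply: leq_INR; rewrite !expnS !expn0 !muln1 !INR_muln.
  have -> : INR 2800 = 2800%R by rewrite INR_IZR_INZ.
  have -> : INR 1100 = 1100%R by rewrite INR_IZR_INZ.
  have K4 : (INR K ^ 4 <= 81 * L ^ 4)%R.
    have -> : (81 * L ^ 4 = (3 * L) ^ 4)%R by ring.
    by apply: pow_incr; lra.
  apply: Rle_trans cL.
  set lhs := (X in (X <= _)%R).
  have -> : (lhs = (2800 * 1100 * INR e ^ 4) * INR K ^ 4)%R by rewrite /lhs; ring.
  have -> : (c * L ^ 4 / 3125 = (2800 * 1100 * INR e ^ 4) * (81 * L ^ 4))%R by rewrite /c; field.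
  by apply: Rmult_le_compat_l => //; lra.
- by lra.
apply: Rle_trans cL.
have L3 : (0 < L ^ 3)%R by apply: pow_lt; lra.
have -> : (c * L ^ 4 / 3125 = (2800 * 1100 * 81 * INR e ^ 4) * (L * L ^ 3))%R by rewrite /c; field.
have h1 : (INR e * 1000000 <= 2800 * 1100 * 81 * INR e ^ 4)%R by lra.
have h2 : (L ^ 3 <= L * L ^ 3)%R by nra.
by apply: Rmult_le_compat; lra.
Qed.

Lemma eps_sequence (P : nat -> R -> Prop) :
  (forall n x y, P n x -> (x <= y)%R -> P n y) ->
  (forall n x, P n x -> (0 <= x)%R) -> (forall n, exists x, P n x) ->
  (forall e, (0 < e)%R -> exists N : nat, forall n : nat, N <= n -> P n e) ->
  exists eps : nat -> R, Un_cv eps 0 /\ forall n, P n (eps n).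
Proof.
move=> mono P0 exP evP.
have near n : exists x, P n x /\ forall y, P n y -> (x <= y + / INR n.+1)%R.
  pose E x := P n (- x)%R.
  have bE : bound E by exists 0%R => x /P0; lra.
  have neE : exists x, E x by have [x Px] := exP n; exists (- x)%R; rewrite /E Ropp_involutive.
  have [l [ub lub]] := completeness E bE neE.
  have i0 : (0 < / INR n.+1)%R by apply: Rinv_0_lt_compat; apply: INR_pos.
  have [x [Ex lt_x]] : exists x, E x /\ (l - / INR n.+1 < x)%R.
    apply: NNPP => nex.
    have ub' : is_upper_bound E (l - / INR n.+1)%R.
      by move=> x Ex; apply: Rnot_lt_le => lt_x; apply: nex; exists x.
    by have := lub _ ub'; lra.
  exists (- x)%R; split=> // y Py; have := ub (- y)%R; rewrite /E Ropp_involutive => /(_ Py); lra.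
pose eps n := proj1_sig (constructive_indefinite_description _ (near n)).
have epsP n := proj2_sig (constructive_indefinite_description _ (near n)).
exists eps; split; last by move=> n; case: (epsP n).
move=> e e0; have e2 : (0 < e / 2)%R by lra.
have [N HN] := evP _ e2.
have [k [k1 _]] := @nat_between (/ (e / 2))%R (Rlt_le _ _ (Rinv_0_lt_compat _ e2)).
exists (maxn N k) => n /leP le_n.
have leN : N <= n by apply: leq_trans le_n; apply: leq_maxl.
have lek : k <= n by apply: leq_trans le_n; apply: leq_maxr.
have [Pn minn] := epsP n; rewrite -/(eps n) in Pn minn.
have := minn _ (HN n leN); have := P0 _ _ Pn.
have h : (/ INR n.+1 < e / 2)%R.
  rewrite -[X in (_ < X)%R]Rinv_inv; apply: Rinv_lt_contravar.
    by apply: Rmult_lt_0_compat; [apply: Rinv_0_lt_compat | apply: INR_pos].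
  by rewrite S_INR; have := INR_leq lek; lra.
by move=> a b; rewrite /R_dist Rminus_0_r Rabs_pos_eq //; lra.
Qed.

Lemma g_upper_ln (e : nat) : 0 < e -> exists L0 : R, (50000 <= L0)%R /\
  forall n m : nat, 0 < n -> 0 < m -> (L0 <= ln (INR n))%R ->
  (INR e * 1000000 * ln (INR n) ^ 3 <= INR n)%R /\
  ((INR m <= INR n ^ 2)%R -> (771 * INR e * ln (INR n) * INR n <= INR m)%R ->
   s n m < g n m -> 'C(g n m - g n m %/ e, 2) < m).
Proof.
move=> e_gt0; have [L0 [L0_ge par]] := density_parameter e_gt0.
exists L0; split=> // n m n_gt0 m_gt0 le_L.
have [K [K_gt0 big [K_lo K_hi] n_big]] := par n n_gt0 le_L.
split=> // le_m lo; apply: (@g_upper n m K e) => //.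
  apply: leq_INR; apply: Rle_trans K_lo; apply: snd_le_ln => //; lra.
apply: leq_INR; apply: Rle_trans lo; rewrite !INR_muln.
have -> : INR 257 = 257%R by rewrite INR_IZR_INZ.
apply: Rmult_le_compat_r; first exact: pos_INR.
have e0 := pos_INR e; have := Rmult_le_compat_l _ _ _ e0 K_hi; lra.
Qed.

Lemma INR_trunc_div (x e : nat) : 0 < e -> (INR (x %/ e) <= INR x / INR e)%R.
Proof.
move=> e_gt0; have e0 := INR_pos e_gt0.
apply: (Rmult_le_reg_r (INR e)) => //; rewrite -INR_muln.
have -> : (INR x / INR e * INR e = INR x)%R by field; lra.
exact: INR_leq (leq_trunc_div _ _).
Qed.

Lemma INR_subn_div (x e : nat) : 0 < e -> (INR x * (1 - / INR e) <= INR (x - x %/ e))%R.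
Proof.
move=> e_gt0; have e0 := INR_pos e_gt0.
have h : (x - x %/ e + x %/ e = x)%N by rewrite subnK // leq_div.
have := congr1 INR h; rewrite INR_addn; have := INR_trunc_div x e_gt0.
have -> : (INR x * (1 - / INR e) = INR x - INR x / INR e)%R by field; lra.
by lra.
Qed.

Lemma exact_range : exists C : R, forall n m : nat, 0 < n -> 0 < m ->
  (C * INR n * ln (INR n) <= INR m <= INR n ^ 2 / (12 * (ln (INR n)) ^ 2))%R ->
  g n m = s n m.
Proof.
have [L0 [L0_ge up]] := @g_upper_ln 20 isT.
exists (15420 + exp L0)%R => n m n_gt0 m_gt0; set L := ln (INR n) => -[lo hi].
have n0 := INR_pos n_gt0; have m0 := INR_pos m_gt0; have x0 := exp_pos L0.
have n2 : 1 < n.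
  rewrite ltn_neqAle n_gt0 andbT; apply/eqP => n1; move: hi.
  rewrite /L -n1 /= ln_1 Rmult_0_l Rmult_0_r /Rdiv Rinv_0; lra.
have L_half : (1 / 2 <= L)%R.
  have h : (2 <= INR n)%R by have := INR_leq n2.
  have i : (/ INR n <= / 2)%R by apply: Rinv_le_contravar; lra.
  by have := ln_ge_1_sub_inv n0; rewrite -/L; lra.
have sq : (INR m * (12 * L ^ 2) <= INR n ^ 2)%R.
  have := Rmult_le_compat_r (12 * L ^ 2) _ _ _ hi.
  have -> : (INR n ^ 2 / (12 * L ^ 2) * (12 * L ^ 2) = INR n ^ 2)%R by field; lra.
  by apply; nra.
have n_ge : (3 * (15420 + exp L0) * L <= INR n)%R.
  have h1 : (3 * INR m <= INR m * (12 * L ^ 2))%R.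
    have : (1 / 4 <= L ^ 2)%R by nra.
    by move=> h; nra.
  have h2 : (3 * ((15420 + exp L0) * INR n * L) <= INR n * INR n)%R by nra.
  by apply: (Rmult_le_reg_r (INR n)) => //; lra.
have le_L : (L0 <= L)%R.
  apply: Rnot_lt_le => lt_L; have := exp_increasing _ _ lt_L; rewrite /L exp_ln // -/L => lt_n.
  by nra.
have [n_big upp] := up n m n_gt0 m_gt0 le_L.
rewrite -/L in n_big upp.
have le_m2 : (2 * INR m <= INR n ^ 2)%R.
  have h : (2 <= 12 * L ^ 2)%R by nra.
  by nra.
have le_mC : m <= 'C(n.+1, 2).
  by apply: leq_INR; rewrite INR_bin2 S_INR; nra.
apply/eqP; rewrite eqn_leq g_geq_s // andbT leqNgt; apply/negP=> lt_sg.
have E20 : INR 20 = 20%R by rewrite INR_IZR_INZ.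
have lt_C : 'C(g n m - g n m %/ 20, 2) < m.
  apply: upp => //; first by nra.
  apply: Rle_trans lo; rewrite E20.
  have : (0 < INR n * L)%R by apply: Rmult_lt_0_compat; lra.
  by nra.
have d2 := snd_ge2 m_gt0.
have dL : (INR (snd m) <= 23 / 10 * L)%R by apply: snd_le_ln => //; rewrite -/L; lra.
have g_big : (INR n <= INR (g n m) * INR (snd m))%R.
  rewrite -INR_muln; apply: INR_leq.
  have h : n < (n %/ snd m).+1 * snd m by rewrite ltn_ceil //; apply: ltnW.
  apply: leq_trans (ltnW h) _; rewrite leq_mul2r; apply/orP; right.
  by move: lt_sg; rewrite /s; move: d2; clear; lia.
have g0 := pos_INR (g n m).
have g_big2 : (INR n <= 23 / 10 * (INR (g n m) * L))%R.
  by have := Rmult_le_compat_l _ _ _ g0 dL; lra.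
have x_ge := @INR_subn_div (g n m) 20 isT.
rewrite E20 in x_ge.
move/ltnW/INR_leq: lt_C; rewrite INR_bin2.
move: x_ge; set x := INR (g n m - _) => x_ge le_x.
have xL : (413 / 1000 * INR n <= x * L)%R.
  have : (INR (g n m) * (19 / 20) * L <= x * L)%R by apply: Rmult_le_compat_r; lra.
  by lra.
have nL : (1000 * L <= INR n)%R.
  apply: Rle_trans n_big; rewrite E20.
  have : (1 <= L ^ 2)%R by nra.
  have -> : (L ^ 3 = L * L ^ 2)%R by ring.
  by nra.
have h1 : (x * L * (x * L - L) <= INR n ^ 2 / 6)%R.
  have L2 : (0 <= L ^ 2)%R by nra.
  have := Rmult_le_compat_r _ _ _ L2 le_x; lra.
have h2 : (0 <= (x * L - 413 / 1000 * INR n) * (x * L + 413 / 1000 * INR n - L))%R.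
  by apply: Rmult_le_pos; lra.
by nra.
Qed.

Lemma asymptotic_range (eps : R) : (0 < eps <= 1)%R ->
  exists N : nat, forall n : nat, N <= n -> forall m : nat, 0 < n -> 0 < m ->
  (INR n ^ 2 / (12 * (ln (INR n)) ^ 2) <= INR m <= INR 'C(n.+1, 2))%R ->
  exists delta : R, (Rabs delta <= eps)%R /\
    INR (g n m) = Rmax (INR (s n m)) ((1 + delta) * sqrt (2 * INR m))%R.
Proof.
move=> [eps0 eps1].
have [|e [e_lo _]] := @nat_between (4 / eps)%R; first by left; apply: Rdiv_lt_0_compat; lra.
have e4 : (4 <= eps * INR e)%R.
  have := Rmult_le_compat_l _ _ _ (Rlt_le _ _ eps0) e_lo.
  by have -> : (eps * (4 / eps) = 4)%R by field; lra.
have e_gt0 : 0 < e.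
  by rewrite lt0n; apply/eqP => E; move: e4; rewrite E /= Rmult_0_r; lra.
have e0 := INR_pos e_gt0.
have [L0 [L0_ge up]] := g_upper_ln e_gt0.
have [N [N_lo _]] := nat_between (Rlt_le _ _ (exp_pos L0)).
exists N => n le_n m n_gt0 m_gt0; set L := ln (INR n) => -[lo hi].
have n0 := INR_pos n_gt0; have m0 := INR_pos m_gt0.
have le_L : (L0 <= L)%R.
  rewrite -(ln_exp L0); have h : (exp L0 <= INR n)%R by have := INR_leq le_n; lra.
  by rewrite /L; case: h => [h|->]; [left; apply: ln_increasing => //; apply: exp_pos | right].
have [n_big upp] := up n m n_gt0 m_gt0 le_L; rewrite -/L in n_big upp.
have le_mC := leq_INR hi.
have n1 : (1 <= INR n)%R by have := INR_leq n_gt0.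
have le_m2 : (INR m <= INR n ^ 2)%R.
  by apply: Rle_trans hi _; rewrite INR_bin2 S_INR; nra.
have L2 : (0 < L ^ 2)%R by nra.
have sq : (INR n ^ 2 <= INR m * (12 * L ^ 2))%R.
  have := Rmult_le_compat_r (12 * L ^ 2) _ _ _ lo.
  have -> : (INR n ^ 2 / (12 * L ^ 2) * (12 * L ^ 2) = INR n ^ 2)%R by field; lra.
  by apply; nra.
have L3 : (L ^ 3 = L * L ^ 2)%R by ring.
have low : (771 * INR e * L * INR n <= INR m)%R.
  apply: (Rmult_le_reg_r (12 * L ^ 2)); first by lra.
  apply: Rle_trans sq.
  have -> : (771 * INR e * L * INR n * (12 * L ^ 2) = (INR e * 9252 * L ^ 3) * INR n)%R by ring.
  rewrite -[X in (_ <= X)%R]/(INR n * (INR n * 1))%R Rmult_1_r.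
  apply: Rmult_le_compat_r; first lra.
  apply: Rle_trans n_big; apply: Rmult_le_compat_r; last lra.
  by rewrite L3; nra.
set M := sqrt (2 * INR m).
have M0 : (0 < M)%R by apply: sqrt_lt_R0; lra.
have MM : (M * M = 2 * INR m)%R by apply: sqrt_sqrt; lra.
have M_big : (4 <= eps * M)%R.
  have h : (INR e * INR e <= M * M)%R.
    rewrite MM; apply: (@Rle_trans _ (INR e * INR n)); last first.
      have L1 : (1 <= L)%R by lra.
      by nra.
    apply: Rmult_le_compat_l; first lra.
    have L31 : (1 <= L ^ 3)%R by apply: pow_R1_Rle; lra.
    by apply: Rle_trans n_big; nra.
  have : (INR e <= M)%R by apply: Rsqr_incr_0; rewrite /Rsqr; lra.
  by nra.
have g_lo := g_geq_sqrt m_gt0 le_mC; rewrite -/M in g_lo.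
have s_g := g_geq_s n_gt0 m_gt0 le_mC.
have [lt_sg|ge_sg] := ltnP (s n m) (g n m); last first.
  have E : g n m = s n m by apply/eqP; rewrite eqn_leq ge_sg.
  exists (- eps)%R; split; first by rewrite Rabs_Ropp Rabs_pos_eq; lra.
  by rewrite -E Rmax_left //; lra.
exists (INR (g n m) / M - 1)%R; split; last first.
  have -> : ((1 + (INR (g n m) / M - 1)) * M = INR (g n m))%R by field; lra.
  by rewrite Rmax_right //; apply: INR_leq; apply: ltnW.
have gM : (INR (g n m) / M * M = INR (g n m))%R by field; lra.
apply: Rabs_le; split.
  by apply: (Rmult_le_reg_r M) => //; lra.
apply: (Rmult_le_reg_r M) => //.
have lt_C := upp le_m2 low lt_sg.
have x_ge := INR_subn_div (g n m) e_gt0.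
move/ltnW/INR_leq: lt_C; rewrite INR_bin2; move: x_ge; set x := INR (g n m - _) => x_ge le_x.
have x_M : (x <= M + 1)%R.
  by apply: Rnot_lt_le => lt_x; nra.
have ie : (/ INR e <= eps / 4)%R.
  have e1 : (INR e * / INR e = 1)%R by field; lra.
  have i0 : (0 < / INR e)%R by apply: Rinv_0_lt_compat.
  by nra.
have g0 := pos_INR (g n m).
have h : (INR (g n m) * (1 - eps / 4) <= M + 1)%R by nra.
have h2 : (M + 1 <= (1 + eps) * M * (1 - eps / 4))%R by nra.
have h3 : (INR (g n m) <= (1 + eps) * M)%R.
  by apply: (Rmult_le_reg_r (1 - eps / 4)); lra.
by lra.
Qed.

Theorem theorem1p7 :
  exists C : R, exists eps : nat -> R, Un_cv eps 0%R /\
  forall n m : nat, (0 < n)%N -> (0 < m)%N ->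
    ((C * INR n * ln (INR n) <= INR m <= INR n ^ 2 / (12 * (ln (INR n)) ^ 2))%R ->
       g n m = s n m) /\
    ((INR n ^ 2 / (12 * (ln (INR n)) ^ 2) <= INR m <= INR 'C(n.+1, 2))%R ->
       exists delta : R, (Rabs delta <= eps n)%R /\
         INR (g n m) = Rmax (INR (s n m)) ((1 + delta) * sqrt (2 * INR m))%R).
Proof.
have [C HC] := exact_range; exists C.
pose P (n : nat) (x : R) := (0 <= x)%R /\ forall m : nat, 0 < n -> 0 < m ->
  (INR n ^ 2 / (12 * (ln (INR n)) ^ 2) <= INR m <= INR 'C(n.+1, 2))%R ->
  exists delta : R, (Rabs delta <= x)%R /\
    INR (g n m) = Rmax (INR (s n m)) ((1 + delta) * sqrt (2 * INR m))%R.
have mono n x y : P n x -> (x <= y)%R -> P n y.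
  move=> [x0 H] le_xy; split; first lra.
  by move=> m n_gt0 m_gt0 rg; have [d [d1 d2]] := H m n_gt0 m_gt0 rg; exists d; split=> //; lra.
have [eps [cv Peps]] : exists eps : nat -> R, Un_cv eps 0 /\ forall n, P n (eps n).
  apply: eps_sequence => //.
  - by move=> n x [].
  - move=> n; exists (INR n + 2)%R; have n0 := pos_INR n; split; first lra.
    move=> m n_gt0 m_gt0 [_ hi]; have le_mC := leq_INR hi.
    have m1 : (1 <= INR m)%R by have := INR_leq m_gt0.
    set M := sqrt (2 * INR m).
    have M1 : (1 <= M)%R by rewrite -sqrt_1; apply: sqrt_le_1_alt; lra.
    have s_g := g_geq_s n_gt0 m_gt0 le_mC.
    have g0 := pos_INR (g n m).
    have [lt_sg|ge_sg] := ltnP (s n m) (g n m); last first.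
      have E : g n m = s n m by apply/eqP; rewrite eqn_leq ge_sg.
      exists (-1)%R; split; first by rewrite Rabs_left; lra.
      by rewrite -E Rmax_left //; lra.
    exists (INR (g n m) / M - 1)%R; split; last first.
      have -> : ((1 + (INR (g n m) / M - 1)) * M = INR (g n m))%R by field; lra.
      by rewrite Rmax_right //; apply: INR_leq; apply: ltnW.
    have le_g : (INR (g n m) <= INR n + 1)%R.
      have [A [_ _ cA]] := g_attained n m_gt0.
      by rewrite -S_INR -cA; apply: INR_leq; rewrite -[X in _ <= X]card_ord max_card.
    have gM : (INR (g n m) / M * M = INR (g n m))%R by field; lra.
    have q0 : (0 <= INR (g n m) / M)%R by apply: Rmult_le_pos => //; left; apply: Rinv_0_lt_compat; lra.
    by apply: Rabs_le; split; nra.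
  move=> e e0.
  have [|N HN] := @asymptotic_range (Rmin e 1).
    by split; [apply: Rmin_glb_lt; lra | apply: Rmin_r].
  exists N => n le_n; apply: mono (Rmin_l e 1); split; last exact: HN.
  by apply: Rmin_glb; lra.
exists eps; split=> // n m n_gt0 m_gt0; split; first exact: HC.
by case: (Peps n) => _; apply.
Qed.
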